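(* Let $\mathscr X$ be a Banach space, $\mathscr Y$ a Hilbert space and $A:\mathscr X\to\mathscr Y$ a bounded linear operator. Let $\mathcal R:\mathscr X\to[0,\infty]$ be proper, lower semi-continuous and $c_0$-strongly convex for some $c_0>0$, assume $Ax=y$ has a solution in $\mathrm{dom}(\mathcal R)$, and let $x^\dagger$ be its unique $\mathcal R$-minimizing solution. Let $y_1,y_2,\dots$ be independent identically distributed $\mathscr Y$-valued random variables with $\mathbb E[y_1]=y$ and $0<\sigma^2:=\mathbb E[\|y_1-y\|^2]<\infty$; for $n\ge2$ set $\bar y^{(n)}=\frac1n\sum_{i=1}^n y_i$ and $s_n=\sqrt{\frac1{n-1}\sum_{i=1}^n\|y_i-\bar y^{(n)}\|^2}$. Define, with $\lambda_0^{(n)}=0$, $$x_t^{(n)}=\arg\min_{x\in\mathscr X}\{\mathcal R(x)-\langle\lambda_t^{(n)},Ax\rangle\},\qquad \lambda_{t+1}^{(n)}=\lambda_t^{(n)}-\gamma(Ax_t^{(n)}-\bar y^{(n)}),$$ with $0<\gamma<2c_0/\|A\|^2$. Let $\beta_0>0$ and let $\tau_n>1$ satisfy $\tau_n\to\infty$ and $\tau_n/\sqrt n\to0$. Let $t_n$ be the first integer $t\ge0$ such that $t\le\beta_0n$ and $\|Ax_t^{(n)}-\bar y^{(n)}\|\le\tau_ns_n/\sqrt n$; if no such integer exists, set $t_n=\beta_0n$. Assume $x^\dagger$ satisfies the variational source condition: there are a function $\mathcal E^\dagger:\mathrm{dom}(\mathcal R)\to[0,\infty)$ with $\mathcal E^\dagger(x^\dagger)=0$,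 a number $0<q\le1$ and a constant $M>0$ such that $\mathcal E^\dagger(x)\le\mathcal R(x)-\mathcal R(x^\dagger)+M\|Ax-y\|^q$ for all $x\in\mathrm{dom}(\mathcal R)$. Then, with $\phi(n):=\frac{\sigma\tau_n}{2\sqrt n}$, there is a constant $C$ such that $$\mathbb P\big(\mathcal E^\dagger(x_{t_n}^{(n)})\le C\phi(n)^q\big)\to1\quad\text{as }n\to\infty.$$
   Context: A proper function $f$ is $c_0$-strongly convex if $f(s\bar x+(1-s)x)+c_0s(1-s)\|\bar x-x\|^2\le sf(\bar x)+(1-s)f(x)$ for all $\bar x,x\in\mathrm{dom}(f)$, $s\in[0,1]$. The $\mathcal R$-minimizing solution satisfies $Ax^\dagger=y$ and $\mathcal R(x^\dagger)=\min\{\mathcal R(x):Ax=y\}$. *)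

(* Defs.v *)
From HB Require Import structures.
From mathcomp Require Import all_boot all_order all_algebra.
From mathcomp Require Import all_classical all_reals all_analysis.
Set Implicit Arguments. Unset Strict Implicit. Unset Printing Implicit Defensive.
Import Order.TTheory GRing.Theory Num.Theory.
Import numFieldNormedType.Exports.
Local Open Scope classical_set_scope.
Local Open Scope ring_scope.

(* An inner product on a real normed space Y inducing its norm.
   Together with completeness of Y this makes Y a (real) Hilbert space. *)
Definition is_inner_product (R : realType) (Y : normedModType R)
  (ip : Y -> Y -> R) : Prop :=
  [/\ (forall u v, ip u v = ip v u),
      (forall a u v w, ip (a *: u + v) w = a * ip u w + ip v w) &
      (forall u, `|u| ^+ 2 = ip u u)].

Definition opnorm (R : realType) (X Y : normedModType R) (A : X -> Y) : R :=
  sup [set `|A x| | x in [set x : X | `|x| <= 1]].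

Definition bounded_op (R : realType) (X Y : normedModType R) (A : X -> Y) :=
  exists C : R, forall x, `|A x| <= C * `|x|.

Definition dom (R : realType) (X : Type) (f : X -> \bar R) : set X :=
  [set x | f x < +oo]%E.

Definition strongly_convex (R : realType) (X : normedModType R)
  (f : X -> \bar R) (c0 : R) : Prop :=
  forall xb x s, dom f xb -> dom f x -> 0 <= s <= 1 ->
    (f (s *: xb + (1 - s) *: x)%R + (c0 * s * (1 - s) * `|xb - x| ^+ 2)%:E
      <= s%:E * f xb + (1 - s)%:E * f x)%E.

Definition proper_fun (R : realType) (X : Type) (f : X -> \bar R) : Prop :=
  (forall x, f x != -oo)%E /\ exists x, (f x < +oo)%E.

Definition Borel (Y : topologicalType) : set (set Y) :=
  <<s [set U : set Y | open U] >>.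

Section RV.
Context (R : realType) (d : measure_display) (T : measurableType d)
  (Y : normedModType R).

Definition simple_rv (f : T -> Y) (s : seq Y) : Prop :=
  (forall w, f w \in s) /\ (forall v, measurable (f @^-1` [set v])).

Definition simple_mean (P : probability T R) (f : T -> Y) (s : seq Y) : Y :=
  \sum_(v <- undup s) fine (P (f @^-1` [set v])) *: v.

Definition strongly_measurable (f : T -> Y) : Prop :=
  exists (fk : nat -> T -> Y) (sk : nat -> seq Y),
    (forall k, simple_rv (fk k) (sk k)) /\
    (forall w, (fun k => fk k w) @ \oo --> f w).

Definition bochner_mean (P : probability T R) (f : T -> Y) (m : Y) : Prop :=
  exists (fk : nat -> T -> Y) (sk : nat -> seq Y),
    [/\ (forall k, simple_rv (fk k) (sk k)),
        (fun k => (\int[P]_w (`|fk k w - f w|)%:E)%E) @ \oo --> 0%E &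
        (fun k => simple_mean P (fk k) (sk k)) @ \oo --> m].

Definition mutually_independent (P : probability T R) (ys : nat -> T -> Y) :=
  forall (s : seq nat) (B : nat -> set Y), uniq s ->
    (forall i, i \in s -> Borel (B i)) ->
    P (\bigcap_(i in [set` s]) (ys i @^-1` B i)) =
      (\prod_(i <- s) P (ys i @^-1` B i))%E.

Definition identically_distributed (P : probability T R) (ys : nat -> T -> Y) :=
  forall i (B : set Y), Borel B -> P (ys i @^-1` B) = P (ys 0%N @^-1` B).

End RV.

Definition sample_mean (R : realType) (T : Type) (Y : normedModType R)
  (ys : nat -> T -> Y) (n : nat) (w : T) : Y :=
  (n%:R)^-1 *: \sum_(i < n) ys i w.

Definition sample_sd (R : realType) (T : Type) (Y : normedModType R)
  (ys : nat -> T -> Y) (n : nat) (w : T) : R :=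
  Num.sqrt ((n.-1%:R)^-1 * \sum_(i < n) `|ys i w - sample_mean ys n w| ^+ 2).

Definition first_index (P : nat -> Prop) (N : nat) : nat :=
  head N [seq t <- iota 0 N.+1 | `[< P t >]].

(* Main.v *)
(* The dual objective [lam |-> sup_x (<lam, A x - ybar> - R x)] is convex and,
   by strong convexity of [R], smooth, and the iteration is gradient descent on
   it with gradient [A x_t - ybar].  Comparing the iterates with a multiplier
   [mu] such that [|mu| <= K phi^(q-1)] and [R - R xdag >= <mu, A . - y> - K phi^q],
   which the source condition provides, and using that [|A x_t - ybar| >= phi]
   before stopping while [|ybar - y| <= phi/4], one gets
   [t = O(phi^(q-2))] and [|lam_t| = O(phi^(q-1))] up to the stopping time.
   Since [phi^(q-2) = o(n)], the discrepancy principle stops the iteration, and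
   [R x_t - R xdag <= <lam_t, A x_t - y> = O(phi^q)] by minimality of [x_t].

   The two facts needed from the sample, [|ybar - y| <= phi/4] and
   [sigma/2 <= s_n <= 2 sigma], hold with probability tending to one: the first
   by Chebyshev's inequality, as [tau_n] tends to infinity and distinct
   [y_i - y] are orthogonal in mean, the second by the weak law of large
   numbers for [|y_i - y|^2], obtained by truncation. *)
Require Import Defs.
From HB Require Import structures.
From mathcomp Require Import all_boot all_order all_algebra.
From mathcomp Require Import all_classical all_reals all_analysis.
From mathcomp Require Import measurable_realfun ring lra.
Import Order.TTheory GRing.Theory Num.Theory.
Import numFieldNormedType.Exports.
Local Open Scope classical_set_scope.
Local Open Scope ring_scope.

(** * Inner products *)

Section InnerProduct.
Context {R : realType} {Y : normedModType R} {ip : Y -> Y -> R}.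
Hypothesis hip : is_inner_product ip.

Lemma ipC u v : ip u v = ip v u.
Proof. by case: hip => + _ _; exact. Qed.

Lemma ip_norm u : ip u u = `|u| ^+ 2.
Proof. by case: hip => _ _ ->. Qed.

Lemma ipDl u v w : ip (u + v) w = ip u w + ip v w.
Proof. by case: hip => _ h _; rewrite -{1}(scale1r u) h mul1r. Qed.

Lemma ip0l w : ip 0 w = 0.
Proof. by have := ipDl 0 0 w; rewrite addr0 -[LHS]addr0 => /addrI. Qed.

Lemma ipZl a u w : ip (a *: u) w = a * ip u w.
Proof. by case: hip => _ h _; rewrite -{1}[a *: u]addr0 h ip0l addr0. Qed.

Lemma ipNl u w : ip (- u) w = - ip u w.
Proof. by rewrite -scaleN1r ipZl mulN1r. Qed.

Lemma ipBl u v w : ip (u - v) w = ip u w - ip v w.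
Proof. by rewrite ipDl ipNl. Qed.

Lemma ip0r w : ip w 0 = 0.
Proof. by rewrite ipC ip0l. Qed.

Lemma ipDr w u v : ip w (u + v) = ip w u + ip w v.
Proof. by rewrite ipC ipDl !(ipC w). Qed.

Lemma ipZr w a u : ip w (a *: u) = a * ip w u.
Proof. by rewrite ipC ipZl (ipC w). Qed.

Lemma ipNr w u : ip w (- u) = - ip w u.
Proof. by rewrite ipC ipNl (ipC w). Qed.

Lemma ipBr w u v : ip w (u - v) = ip w u - ip w v.
Proof. by rewrite ipDr ipNr. Qed.

Lemma ip_suml (I : Type) (s : seq I) (F : I -> Y) w :
  ip (\sum_(i <- s) F i) w = \sum_(i <- s) ip (F i) w.
Proof. exact: (big_morph (fun u => ip u w) (fun u v => ipDl u v w) (ip0l w)). Qed.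

Lemma ip_sumr (I : Type) (s : seq I) (F : I -> Y) w :
  ip w (\sum_(i <- s) F i) = \sum_(i <- s) ip w (F i).
Proof. by rewrite ipC ip_suml; apply: eq_bigr => i _; rewrite ipC. Qed.

Lemma normD_sqr u v : `|u + v| ^+ 2 = `|u| ^+ 2 + 2 * ip u v + `|v| ^+ 2.
Proof. by rewrite -!ip_norm !(ipDl, ipDr) (ipC v u); ring. Qed.

Lemma normB_sqr u v : `|u - v| ^+ 2 = `|u| ^+ 2 - 2 * ip u v + `|v| ^+ 2.
Proof. by rewrite normD_sqr ipNr normrN; ring. Qed.

Lemma normZ_sqr a (u : Y) : `|a *: u| ^+ 2 = a ^+ 2 * `|u| ^+ 2.
Proof. by rewrite normrZ exprMn real_normK// num_real. Qed.

Lemma cauchy_schwarz u v : `|ip u v| <= `|u| * `|v|.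
Proof.
have [->|v0] := eqVneq v 0; first by rewrite ip0r normr0 mulr_ge0.
have vgt0 : 0 < `|v| by rewrite normr_gt0.
rewrite -(@ler_pXn2r _ 2) ?nnegrE ?mulr_ge0// real_normK ?num_real//.
have := sqr_ge0 (`| `|v| ^+ 2 *: u - ip u v *: v |).
rewrite normB_sqr !normZ_sqr ipZl ipZr => h.
have {h} : 0 <= `|v| ^+ 2 * ((`|u| * `|v|) ^+ 2 - ip u v ^+ 2).
  by apply: le_trans h _; rewrite le_eqVlt; apply/orP; left; apply/eqP; ring.
by rewrite pmulr_rge0 ?exprn_gt0// subr_ge0.
Qed.

Lemma ip_le_norm u v : ip u v <= `|u| * `|v|.
Proof. exact: le_trans (ler_norm _) (cauchy_schwarz u v). Qed.

End InnerProduct.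

(** * Dual gradient descent *)

Section Landweber.
Context {R : realType} {X Y : normedModType R} {ip : Y -> Y -> R}.
Hypothesis hip : is_inner_product ip.
Context {A : {linear X -> Y}} {D : set X} {r : X -> R} {c0 gamma : R}.
Hypotheses (hc0 : 0 < c0) (hgamma : 0 < gamma).
Hypothesis hr0 : forall z, D z -> 0 <= r z.
Hypothesis hconv : forall a b s, D a -> D b -> 0 <= s <= 1 ->
  D (s *: a + (1 - s) *: b) /\
  r (s *: a + (1 - s) *: b) + c0 * s * (1 - s) * `|a - b| ^+ 2
    <= s * r a + (1 - s) * r b.
Hypothesis hAc : forall u, gamma / 2 * `|A u| ^+ 2 <= c0 * `|u| ^+ 2.

Lemma quasi_minimizer (F : X -> R) e : (exists z, D z) ->
  (forall z, D z -> 0 <= F z) -> 0 < e ->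
  exists2 z, D z & forall z', D z' -> F z <= F z' + e.
Proof.
move=> [z0 Dz0] F0 e0.
have hi : has_inf (F @` D).
  by split; [exists (F z0), z0|exists 0 => _ [z Dz <-]; exact: F0].
have [_ [z Dz <-] hz] := inf_adherent e0 hi.
exists z => // z' Dz'; apply: le_trans (ltW hz) _.
by rewrite lerD2r; apply: ge_inf; [exact: hi.2|exists z'].
Qed.

(** Solves the quadratic inequality for the residual of an almost minimizer: if [a > 2 (m + 1) p],
    then [a ^ 2] exceeds [2 (m + 1) p a], which already dominates the right side. *)
Lemma sqr_bound (a m p : R) : 0 <= m -> 0 <= p ->
  a ^+ 2 <= 2 * p * (m * (p + a) + p) -> a <= 2 * (m + 1) * p.
Proof.
move=> m0 p0 h; rewrite leNgt; apply/negP => ha.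
suff : 2 * p * (m * (p + a) + p) < a ^+ 2 by rewrite ltNge h.
have : 0 < (a - 2 * (m + 1) * p) * a by rewrite mulr_gt0; nra.
nra.
Qed.

(* The multiplier comes from the Tikhonov functional
   [r z + |A z - y|^2 / (2 alpha)]: strong convexity absorbs the quadratic
   error of the first-order condition, so that an almost minimizer suffices. *)
Lemma approximate_multiplier (y : Y) (xdag : X) (M P psi : R) :
  D xdag -> A xdag = y -> 0 <= M -> 0 < P -> 0 < psi ->
  (forall z, D z -> r xdag - r z <= M * P * (psi + `|A z - y|)) ->
  exists2 mu : Y, `|mu| <= (M + 1) * (2 * M + 3) * P &
    forall z, D z ->
      ip mu (A z - y) <= r z - r xdag + (M + 1) * (2 * M + 3) * P * psi.
Proof.
move=> Dxd Axd M0 P0 psi0 hvsc.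
(* This regularization parameter balances two scales: the residual will be of order [psi], hence the
   multiplier of order [psi / al = P]. *)
pose al := psi / P.
have al0 : 0 < al by rewrite divr_gt0.
have Pal : P * al = psi by rewrite /al mulrC divfK// gt_eqF.
(* The step [s] solves [s = (1 - s) gamma al], so that [s |A h|^2 / (2 al) = (1 - s) gamma / 2 |A
   h|^2], which [hAc] bounds by the strong convexity term. *)
pose s := gamma * al / (1 + gamma * al).
have gal0 : 0 < gamma * al by rewrite mulr_gt0.
have s0 : 0 < s by rewrite divr_gt0// addr_gt0.
have hs : s * (1 + gamma * al) = gamma * al by rewrite divfK// gt_eqF// addr_gt0.
have s1 : s <= 1 by rewrite ler_pdivrMr ?mul1r ?addr_gt0// lerDr.
clearbody s al.
pose F z := r z + `|A z - y| ^+ 2 / (2 * al).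
have F0 z : D z -> 0 <= F z.
  by move=> Dz; rewrite addr_ge0 ?hr0// divr_ge0 ?sqr_ge0 ?mulr_ge0// ltW.
(* The tolerance carries a factor [s] because the first-order condition below is divided by [s],
   leaving the error [P psi]. *)
have e0 : 0 < s * (P * psi) by rewrite !mulr_gt0.
have [xe De he] := @quasi_minimizer F _ (ex_intro _ _ Dxd) F0 e0.
set r0 := `|A xe - y|.
have r0ge : 0 <= r0 by exact: normr_ge0.
have r0le : r0 <= 2 * (M + 1) * psi.
  apply: sqr_bound => //; first exact: ltW.
  have := he _ Dxd; rewrite /F Axd subrr normr0 expr0n/= mul0r addr0 -/r0.
  have := hvsc _ De; rewrite -/r0 => h1 h2.
  have sPpsi : s * (P * psi) <= P * psi by rewrite ler_piMl// mulr_ge0 ?ltW.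
  have h3 : r0 ^+ 2 / (2 * al) <= M * P * (psi + r0) + P * psi by lra.
  have := h3; rewrite ler_pdivrMr ?mulr_gt0// => /le_trans; apply.
  by rewrite le_eqVlt; apply/orP; left; apply/eqP; rewrite -Pal; ring.
(* The multiplier is minus the gradient of the penalty [|v - y|^2 / (2 al)] at [v = A xe]. *)
pose mu := - (al^-1 *: (A xe - y)).
exists mu.
  rewrite normrN normrZ ger0_norm ?invr_ge0 ?(ltW al0)// -/r0.
  rewrite [al^-1 * _]mulrC ler_pdivrMr//.
  have -> : (M + 1) * (2 * M + 3) * P * al = (M + 1) * (2 * M + 3) * psi.
    by rewrite -Pal; ring.
  by rewrite (le_trans r0le)// ler_wpM2r ?(ltW psi0)//; nra.
move=> z Dz.
have [Dm hm] := hconv _ _ s Dz De (introT andP (conj (ltW s0) s1)).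
have := he _ Dm; rewrite /F -/r0.
set h := z - xe in hm *.
have -> : A (s *: z + (1 - s) *: xe) - y = (A xe - y) + s *: A h.
  rewrite /h linearD !linearZ linearB /= scalerBr scalerBl scale1r.
  by rewrite addrCA addrAC.
rewrite (normD_sqr hip (A xe - y)) normZ_sqr (ipZr hip) -/r0 => hmin.
have hAh := hAc h.
have al2 : 2 * al != 0 by rewrite gt_eqF// mulr_gt0.
have muh : ip mu (A h) = - (ip (A xe - y) (A h) / al).
  by rewrite /mu (ipNl hip) (ipZl hip) mulrC.
have mur : ip mu (A xe - y) = - (r0 ^+ 2 / al).
  by rewrite /mu (ipNl hip) (ipZl hip) (ip_norm hip) mulrC.
(* Comparing [xe] with [s z + (1 - s) xe] and dividing by [s] gives the approximate first-order
   condition. *)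
have key : ip mu (A h) <= r z - r xe + P * psi.
  rewrite -(ler_pM2l s0).
  have quad : s * (s * `|A h| ^+ 2 / (2 * al)) <= s * (c0 * (1 - s) * `|h| ^+ 2).
    rewrite ler_pM2l// ler_pdivrMr ?mulr_gt0//.
    have hs' : s = (1 - s) * (gamma * al) by lra.
    rewrite {1}hs'.
    have s1' : 0 <= 1 - s by lra.
    have := ler_wpM2l (mulr_ge0 s1' (ltW al0)) hAh.
    lra.
  rewrite muh.
  have split3 : (r0 ^+ 2 + 2 * (s * ip (A xe - y) (A h)) + s ^+ 2 * `|A h| ^+ 2)
     / (2 * al) = r0 ^+ 2 / (2 * al) + s * (ip (A xe - y) (A h) / al)
       + s * (s * `|A h| ^+ 2 / (2 * al)).
    by field; rewrite gt_eqF.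
  move: hmin; rewrite split3; lra.
(* The residual of [xe] contributes [- r0^2 / al <= 0], and the source bound at [xe] replaces [r xe]
   by [r xdag] at the cost [M (2 M + 3) P psi]. *)
have -> : A z - y = A h + (A xe - y) by rewrite /h linearB/= subrKA.
rewrite (ipDr hip) mur.
have := hvsc _ De; rewrite -/r0.
have : 0 <= r0 ^+ 2 / al by rewrite divr_ge0 ?sqr_ge0// ltW.
have : M * P * (psi + r0) <= M * P * (psi + 2 * (M + 1) * psi).
  by rewrite ler_wpM2l ?mulr_ge0 ?(ltW P0)// lerD2l.
have : 0 <= M * (P * psi) by rewrite !mulr_ge0// ltW.
have : 0 <= P * psi by rewrite mulr_ge0// ltW.
lra.
Qed.

Context {y yb : Y} {xdag : X}.
Hypotheses (Dxd : D xdag) (Axd : A xdag = y).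
Context {x : nat -> X} {lam : nat -> Y}.
Hypothesis hlam0 : lam 0%N = 0.
Hypothesis Dx : forall t, D (x t).
Hypothesis hx : forall t z, D z ->
  r (x t) - ip (lam t) (A (x t)) <= r z - ip (lam t) (A z).
Hypothesis hlam : forall t, lam t.+1 = lam t - gamma *: (A (x t) - yb).

Let g t := A (x t) - yb.
(** By minimality of [x t], this is the dual objective at [lam t], shifted by [r xdag]; [g t] is its
    gradient. *)
Let e t := ip (lam t) (g t) - r (x t) + r xdag.

(** Minimality is tested at [s z + (1 - s) (x t)] and divided by [s]; the loss [s Q] is at most [ep]
    for the small [s] chosen. *)
Lemma strong_minimality t z : D z ->
  r (x t) - ip (lam t) (A (x t)) + c0 * `|z - x t| ^+ 2
    <= r z - ip (lam t) (A z).
Proof.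
move=> Dz; apply/ler_addgt0Pr => ep ep0.
set Q := c0 * `|z - x t| ^+ 2.
have Q0 : 0 <= Q by rewrite mulr_ge0 ?sqr_ge0// ltW.
pose s := ep / (Q + ep).
have Qe : 0 < Q + ep by rewrite ltr_wpDl.
have s0 : 0 < s by rewrite divr_gt0.
have s1 : s <= 1 by rewrite ler_pdivrMr// mul1r lerDr.
have hs : s * (Q + ep) = ep by rewrite divfK// gt_eqF.
clearbody s.
have [Dm hm] := hconv _ _ s Dz (Dx t) (introT andP (conj (ltW s0) s1)).
have := hx t _ Dm; rewrite linearD !linearZ/= (ipDr hip) !(ipZr hip) => h.
have h2 : s * (r (x t) - ip (lam t) (A (x t)) + (1 - s) * Q)
    <= s * (r z - ip (lam t) (A z)) by rewrite /Q; lra.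
move: h2; rewrite ler_pM2l// => h2.
have : s * Q <= ep by rewrite -hs ler_pM2l// lerDl ltW.
lra.
Qed.

(** Descent lemma for the gradient step. Strong minimality of [x t] tested at [x t.+1], together
    with [hAc], leaves the slack [gamma / 2 |g t.+1|^2], which is dropped. *)
Lemma dual_descent t : e t.+1 <= e t - gamma / 2 * `|g t| ^+ 2.
Proof.
have := strong_minimality t _ (Dx t.+1).
have := hAc (x t.+1 - x t).
have : 0 <= gamma / 2 * `|g t - - A (x t.+1 - x t)| ^+ 2.
  by rewrite mulr_ge0 ?sqr_ge0 ?divr_ge0 ?ltW.
rewrite (normB_sqr hip) normrN (ipNr hip) linearB/=.
rewrite /e hlam -/(g t).
have -> : g t.+1 = g t + (A (x t.+1) - A (x t)).
  by rewrite /g [RHS]addrC subrKA.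
rewrite (ipBl hip (lam t)) (ipZl hip) !(ipDr hip _ (g t)) (ip_norm hip) !(ipBr hip).
have -> : ip (lam t) (A (x t)) = ip (lam t) (g t) + ip (lam t) yb.
  by rewrite -(ipDr hip) subrK.
rewrite /g !(ipBr hip).
lra.
Qed.

Lemma dual_lower t : ip (lam t) (y - yb) <= e t.
Proof.
have := hx t _ Dxd; rewrite /e /g Axd !(ipBr hip); lra.
Qed.

(** The left side is a Lyapunov function that does not increase while the residuals are at least
    [phi]. Expanding [|lam t.+1 - mu|^2] produces [gamma^2 |g t|^2], the descent weighted by
    [2 gamma (t + 1)] gives back [- gamma^2 (t + 1) |g t|^2], and the difference pays for the growth
    of the [phi^2] term. *)
Lemma dual_energy (mu : Y) (k phi : R) t : 0 <= phi ->
  (forall z, D z -> ip mu (A z - y) <= r z - r xdag + k) ->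
  (forall s, (s < t)%N -> phi <= `|g s|) ->
  `|lam t - mu| ^+ 2 + 2 * gamma * t%:R * (e t + ip mu (yb - y) - k)
    + gamma ^+ 2 * phi ^+ 2 * (t%:R * (t%:R - 1) / 2) <= `|mu| ^+ 2.
Proof.
move=> phi0 hmu; elim: t => [|t ih] hg.
  by rewrite hlam0 sub0r normrN mulr0 !mul0r !mulr0 !addr0.
have {}ih := ih (fun s st => hg _ (ltnW st)).
apply: le_trans ih.
have hgt := hg _ (ltnSn t).
have hd := dual_descent t.
have hphi : phi ^+ 2 <= `|g t| ^+ 2 by rewrite ler_pXn2r ?nnegrE// (le_trans phi0).
have -> : lam t.+1 - mu = (lam t - mu) - gamma *: g t by rewrite hlam addrAC.
rewrite (normB_sqr hip (lam t - mu)) normZ_sqr (ipZr hip).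
(* Subgradient inequality of the dual objective between [lam t] and [mu], where [hmu] bounds the
   dual value at [mu]. *)
have h1 : ip (lam t - mu) (g t) >= e t + ip mu (yb - y) - k.
  have := hmu _ (Dx t); rewrite (ipBl hip) /e /g !(ipBr hip); lra.
rewrite -[t.+1%:R]natr1.
set T := t%:R; have T0 : 0 <= T by exact: ler0n.
clearbody T.
have a1 := ler_wpM2l (ltW hgamma) h1.
have gT : 0 <= 2 * gamma * (T + 1).
  by rewrite mulr_ge0 ?addr_ge0 ?mulr_ge0// ltW.
have a2 := ler_wpM2l gT hd.
have a3 := ler_wpM2l (mulr_ge0 (sqr_ge0 gamma) T0) hphi.
lra.
Qed.

Lemma dual_bound (mu : Y) (K P phi : R) t : 0 <= K -> 0 < phi -> phi <= P ->
  `|mu| <= K * P ->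
  (forall z, D z -> ip mu (A z - y) <= r z - r xdag + K * P * phi) ->
  `|yb - y| <= phi / 4 ->
  (forall s, (s < t)%N -> phi <= `|g s|) ->
  gamma * t%:R * phi <= (17 * K + 3 * gamma) * P /\
  `|lam t| <= (7 * K + 2 * gamma) * P.
Proof.
move=> K0 phi0 phiP muP hmu hdelta hg.
have := @dual_energy mu _ phi t (ltW phi0) hmu hg.
set a := `|lam t - mu|; set T := t%:R.
have T0 : 0 <= T by exact: ler0n.
clearbody T.
have a0 : 0 <= a by exact: normr_ge0.
have P0 : 0 < P by exact: lt_le_trans phiP.
(* The dual gap can be negative, but only by the noise paired with [lam t - mu]. *)
have hel : - (a * (phi / 4)) <= e t + ip mu (yb - y).
  have := dual_lower t.
  have := ip_le_norm hip (lam t - mu) (yb - y).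
  rewrite -/a (ipBl hip) -[y - yb]opprB (ipNr hip).
  have := ler_wpM2l a0 hdelta.
  lra.
have KP : 0 <= K * P by rewrite mulr_ge0// ltW.
have mu2 : `|mu| ^+ 2 <= (K * P) ^+ 2 by rewrite ler_pXn2r ?nnegrE.
have phi2 : phi ^+ 2 <= P ^+ 2 by rewrite ler_pXn2r ?nnegrE// ltW.
set v := gamma * T * phi.
have v0 : 0 <= v by rewrite !mulr_ge0// ltW.
have gT : 0 <= 2 * gamma * T by rewrite !mulr_ge0// ltW.
have := ler_wpM2l gT hel.
have := ler_wpM2l (sqr_ge0 gamma) phi2.
have gphi : 0 <= gamma ^+ 2 * phi ^+ 2 by rewrite mulr_ge0 ?sqr_ge0.
(* Three Young inequalities: [T <= T^2 / 2 + 1] handles the linear part of [T (T - 1)], and the next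
   two squares split the products [a v] and [K P v]. The weights leave [a^2 / 2 + v^2 / 16] on the
   left. *)
have : 0 <= gamma ^+ 2 * phi ^+ 2 * ((T - 1) ^+ 2 + 1).
  by rewrite mulr_ge0// addr_ge0 ?sqr_ge0.
have := sqr_ge0 (a - v / 2).
have := sqr_ge0 (v - 16 * (K * P)).
move=> q1 q2 q3 q4 q5 q6.
have hav : a ^+ 2 / 2 + v ^+ 2 / 16 <= 17 * (K * P) ^+ 2 + gamma ^+ 2 * P ^+ 2 / 2.
  rewrite /v in q1 q2 *; lra.
have gP : 0 <= gamma * P by rewrite mulr_ge0// ltW.
have KgP : 0 <= (K * P) * (gamma * P) by rewrite mulr_ge0.
split.
  rewrite -/v -(@ler_pXn2r _ 2) ?nnegrE//; last first.
    by rewrite mulr_ge0 ?addr_ge0 ?mulr_ge0 ?(ltW P0) ?(ltW hgamma).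
  have := sqr_ge0 (K * P); have := sqr_ge0 a; have := sqr_ge0 (gamma * P).
  lra.
have : a <= (6 * K + 2 * gamma) * P.
  rewrite -(@ler_pXn2r _ 2) ?nnegrE//; last first.
    by rewrite mulr_ge0 ?addr_ge0 ?mulr_ge0 ?(ltW P0) ?(ltW hgamma).
  have := sqr_ge0 (K * P); have := sqr_ge0 v; have := sqr_ge0 (gamma * P).
  lra.
have : `|lam t| <= a + `|mu| by rewrite -{1}(subrK mu (lam t)) ler_normD.
lra.
Qed.

End Landweber.

(** * Operator norm, fractional powers and first indices *)

Lemma le_opnorm {R : realType} {X Y : normedModType R} {A : {linear X -> Y}} :
  bounded_op A -> forall u, `|A u| <= opnorm A * `|u|.
Proof.
move=> [C hC] u.
have [->|u0] := eqVneq u 0; first by rewrite linear0 !normr0 mulr0.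
have ugt0 : 0 < `|u| by rewrite normr_gt0.
rewrite -ler_pdivrMr//.
apply: ub_le_sup.
  exists `|C| => _ [z /= z1 <-]; apply: le_trans (hC z) _.
  apply: (@le_trans _ _ (`|C| * `|z|)); first by rewrite ler_wpM2r// ler_norm.
  by rewrite ler_piMr.
exists (`|u|^-1 *: u).
  by rewrite /= normrZ ger0_norm ?invr_ge0// mulVf ?normr_eq0.
by rewrite linearZ /= normrZ ger0_norm ?invr_ge0// mulrC.
Qed.

Lemma powRB1 {R : realType} (q s : R) : 0 < s -> s `^ (q - 1) * s = s `^ q.
Proof.
move=> s0; rewrite -{2}(powRr1 (ltW s0)) -powRD ?subrK//.
by rewrite [s == 0]gt_eqF// implybT.
Qed.

(** Linearizes the Hölder term of the source condition at scale [phi]. For [s <= phi] the power is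
    monotone; for [s > phi] one has [s^(q-1) <= phi^(q-1)] because [q <= 1]. *)
Lemma powR_le_affine {R : realType} (q phi s : R) :
  0 < q <= 1 -> 0 < phi -> 0 <= s -> s `^ q <= phi `^ (q - 1) * (phi + s).
Proof.
move=> /andP[q0 q1] phi0 s0.
have [sphi|phis] := leP s phi.
  apply: (@le_trans _ _ (phi `^ q)); first by rewrite ge0_ler_powR ?nnegrE// ltW.
  by rewrite -powRB1// ler_wpM2l ?powR_ge0// lerDl.
have sgt0 : 0 < s by exact: lt_trans phis.
rewrite -powRB1// ler_pM ?powR_ge0//; last by rewrite lerDr ltW.
rewrite -opprB !powRN lef_pV2 ?posrE ?powR_gt0//.
by rewrite ge0_ler_powR ?nnegrE ?subr_ge0// ltW.
Qed.

(** The start [m] is arbitrary so that the induction can pass to the tail of the interval. *)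
Lemma head_filter_iota (Q : nat -> Prop) (d m n : nat) :
  (exists2 t, (m <= t < m + n)%N & Q t) ->
  let h := head d [seq t <- iota m n | `[< Q t >]] in
  Q h /\ forall s, (m <= s < h)%N -> ~ Q s.
Proof.
elim: n m => [|n ih] m [t tmn Qt] /=; first by move: tmn; rewrite addn0; case: ltngtP.
case: asboolP => [Qm|nQm] /=; first by split=> // s; case: ltngtP.
have [|Qh hmin] := ih m.+1.
  exists t => //; move: tmn; rewrite addSnnS => /andP[mt ->]; rewrite andbT.
  by rewrite ltn_neqAle mt andbT; apply/eqP => mt'; apply: nQm; rewrite mt'.
split=> // s; case: (ltngtP m s) => //= [ms sh|<- _ //].
by apply: hmin; rewrite ms sh.
Qed.

Lemma first_indexP (Q : nat -> Prop) (N : nat) :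
  (exists2 t, (t <= N)%N & Q t) ->
  Q (first_index Q N) /\ forall s, (s < first_index Q N)%N -> ~ Q s.
Proof.
move=> [t tN Qt]; have [|Qh hmin] := @head_filter_iota Q N 0 N.+1.
  by exists t => //; rewrite add0n ltnS tN.
by split=> // s sh; apply: hmin; rewrite sh.
Qed.

(** * Error bound at the stopping index for a fixed sample *)

Section Stopping.
Context {R : realType} {X Y : normedModType R} {ip : Y -> Y -> R}.
Hypothesis hip : is_inner_product ip.
Context {A : {linear X -> Y}} {D : set X} {r E : X -> R} {c0 gamma q M : R}.
Hypotheses (hc0 : 0 < c0) (hgamma : 0 < gamma) (hq : 0 < q <= 1) (hM : 0 < M).
Hypothesis hr0 : forall z, D z -> 0 <= r z.
Hypothesis hconv : forall a b s, D a -> D b -> 0 <= s <= 1 ->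
  D (s *: a + (1 - s) *: b) /\
  r (s *: a + (1 - s) *: b) + c0 * s * (1 - s) * `|a - b| ^+ 2
    <= s * r a + (1 - s) * r b.
Hypothesis hAc : forall u, gamma / 2 * `|A u| ^+ 2 <= c0 * `|u| ^+ 2.
Context {y : Y} {xdag : X}.
Hypotheses (Dxd : D xdag) (Axd : A xdag = y).
Hypothesis hE0 : forall z, D z -> 0 <= E z.
Hypothesis hvsc : forall z, D z -> E z <= r z - r xdag + M * `|A z - y| `^ q.

(** Here [K] is fixed before the data, so that one constant serves every sample of a good event. The
    last inequality assumed makes [N] too large for all residuals up to [N] to stay above
    [theta]. *)
Lemma discrepancy_principle_error : exists2 K : R, 0 < K &
  forall (yb : Y) (x : nat -> X) (lam : nat -> Y) (phi theta : R) (N : nat),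
  lam 0%N = 0 -> (forall t, D (x t)) ->
  (forall t z, D z ->
     r (x t) - ip (lam t) (A (x t)) <= r z - ip (lam t) (A z)) ->
  (forall t, lam t.+1 = lam t - gamma *: (A (x t) - yb)) ->
  0 < phi <= 1 -> `|yb - y| <= phi / 4 -> phi <= theta <= 4 * phi ->
  K * phi `^ q < N.+1%:R * phi ^+ 2 ->
  E (x (first_index (fun t => `|A (x t) - yb| <= theta) N)) <= K * phi `^ q.
Proof.
pose K0 := (M + 1) * (2 * M + 3).
have K00 : 0 <= K0 by rewrite mulr_ge0 ?addr_ge0 ?mulr_ge0 ?(ltW hM).
pose K1 := 17 * K0 + 3 * gamma.
pose K2 := 7 * K0 + 2 * gamma.
have K10 : 0 < K1 by apply: ltr_wpDl; [exact: mulr_ge0|exact: mulr_gt0].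
have K20 : 0 < K2 by apply: ltr_wpDl; [exact: mulr_ge0|exact: mulr_gt0].
have K1g : 0 < K1 / gamma by rewrite divr_gt0.
(* In this order, the summands account for the number of steps, for [lam t] paired with a residual
   of norm at most [5 phi], and for the source term at such a residual. *)
exists (K1 / gamma + 5 * K2 + 6 * M).
  by rewrite !addr_gt0// mulr_gt0.
move=> yb x lam phi theta N lam0 Dx hx hlam /andP[phi0 phi1] hdel
  /andP[phith thphi] hN.
set P := phi `^ (q - 1).
have P0 : 0 < P by rewrite powR_gt0.
have PE : P * phi = phi `^ q by rewrite powRB1.
have phiP : phi <= P.
  rewrite -{1}(powRr1 (ltW phi0)) ger_powR ?phi0//.
  by case/andP: hq => _ q1; rewrite lerBlDr (le_trans q1)// lerDl.
have vsc' z : D z -> E z <= r z - r xdag + M * P * (phi + `|A z - y|).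
  move=> Dz; apply: le_trans (hvsc _ Dz) _.
  by rewrite lerD2l -mulrA ler_wpM2l ?(ltW hM)// powR_le_affine.
have [mu mu_le hmu] : exists2 mu : Y, `|mu| <= K0 * P &
    forall z, D z -> ip mu (A z - y) <= r z - r xdag + K0 * P * phi.
  apply: (approximate_multiplier hip hgamma hr0 hconv hAc _ _ _ _ _ Dxd Axd (ltW hM)) => // z Dz.
  by have := vsc' _ Dz; have := hE0 _ Dz; lra.
have bound t := dual_bound hip hc0 hgamma hconv hAc Dxd Axd lam0 Dx hx hlam
  _ _ _ _ t K00 phi0 phiP mu_le hmu hdel.
(* Were the threshold missed up to [N], then [bound N.+1] would contradict [hN]. So the index is a
   genuine stopping time and not the default value. *)
have [|found before] := @first_indexP (fun t => `|A (x t) - yb| <= theta) N.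
  apply: contrapT => hno.
  have [|hT _] := bound N.+1.
    move=> s sN; apply: (le_trans phith); rewrite leNgt; apply/negP => hlt.
    by apply: hno; exists s => //; exact: ltW.
  move: hN; rewrite -PE ltNge => /negP; apply.
  have h1 : N.+1%:R * phi <= K1 / gamma * P.
    rewrite -(ler_pM2l hgamma) !mulrA [gamma * K1]mulrC mulfK ?gt_eqF//.
  have h2 : K1 / gamma * P <= (K1 / gamma + 5 * K2 + 6 * M) * P.
    by rewrite ler_wpM2r ?(ltW P0)// -addrA lerDl addr_ge0// mulr_ge0// ltW.
  rewrite expr2 !mulrA ler_wpM2r ?(ltW phi0)//.
  exact: le_trans h1 h2.
set t := first_index _ _ in found before *.
have [|_ lam_le] := bound t.
  move=> s /before /negP; rewrite -ltNge => /ltW; exact: le_trans.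
have res : `|A (x t) - y| <= 5 * phi.
  have -> : A (x t) - y = (A (x t) - yb) + (yb - y) by rewrite subrKA.
  apply: (le_trans (ler_normD _ _)).
  by apply: (le_trans (lerD (le_trans found thphi) hdel)); lra.
have hxt := hx t _ Dxd.
have hip_le := ip_le_norm hip (lam t) (A (x t) - y).
have hmul : `|lam t| * `|A (x t) - y| <= K2 * P * (5 * phi) by rewrite ler_pM.
have hMP : M * P * (phi + `|A (x t) - y|) <= M * P * (phi + 5 * phi).
  by rewrite ler_wpM2l ?mulr_ge0 ?(ltW hM) ?(ltW P0)// lerD2l.
have := vsc' _ (Dx t).
rewrite -PE => hEt.
have K1P : 0 <= K1 / gamma * (P * phi).
  by rewrite mulr_ge0 ?(ltW K1g)// mulr_ge0 ?(ltW P0) ?(ltW phi0).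
(* Minimality of [x t] against [xdag] bounds [r (x t) - r xdag] by [ip (lam t) (A (x t) - y)]. *)
move: hxt hip_le; rewrite Axd (ipBr hip).
lra.
Qed.

End Stopping.

(** * Strongly measurable random variables *)

Section BorelMaps.
Context {R : realType} {d : measure_display} {T : measurableType d}
  {Y : normedModType R}.

(** The measurable sets of this type are those satisfying [Borel], so that results on measurable
    maps apply to the hypotheses on the sample. *)
Definition borel_space := g_sigma_algebraType [set U : set Y | open U].

Lemma open_borel (U : set borel_space) : open (U : set Y) -> measurable U.
Proof. by move=> oU; apply: sub_sigma_algebra. Qed.

Lemma continuous_borel (f : Y -> R) :
  continuous f -> measurable_fun setT (f : borel_space -> R).
Proof.
move=> cf; apply: (measurability _ (RGenOpens.measurableE R)).
move=> _ [_ [a [b ->]] <-]; rewrite setTI; apply: open_borel.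
by apply: open_comp => //; exact: interval_open.
Qed.

(** As [f] has finitely many values, the preimage of any set is a finite union of level sets. *)
Lemma simple_rv_preimage (f : T -> Y) (s : seq Y) (B : set Y) :
  simple_rv f s -> measurable (f @^-1` B).
Proof.
move=> [fs fm].
have -> : f @^-1` B = \bigcup_(v in [set` s] `&` B) (f @^-1` [set v]).
  apply/seteqP; split=> [w Bfw|w [v [_ Bv] /= ->//]].
  by exists (f w) => //; split=> //; exact: fs.
by apply: fin_bigcup_measurable => //; apply: finite_setIl; exact: finite_seq.
Qed.

(** The limit lies in the open set [U] exactly when, for some [m], the approximants eventually stay
    in [V m], the points whose ball of radius [1 / (m + 1)] is inside [U]. *)
Lemma strongly_measurable_borel (f : T -> Y) :
  strongly_measurable f -> measurable_fun setT (f : T -> borel_space).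
Proof.
move=> [fk [sk [hsimple hcvg]]].
apply: (@measurability _ _ T borel_space setT f [set U : set Y | open U]) => //.
move=> _ [U oU <-]; rewrite setTI.
pose V (m : nat) : set Y := [set v | ball v m.+1%:R^-1 `<=` U].
have -> : f @^-1` U =
    \bigcup_m \bigcup_K \bigcap_(k in [set k | (K <= k)%N]) (fk k @^-1` V m).
  apply/seteqP; split=> [w Ufw|w [m _ [K _ hK]]].
    have /nbhs_ballP[e /= e0 eU] : nbhs (f w) U by apply: open_nbhs_nbhs.
    have [m hm] : exists m, m.+1%:R^-1 < e / 2 :> R.
      have [m _ hm] := near_infty_natSinv_lt (PosNum (divr_gt0 e0 (@ltr0Sn R 1))).
      by exists m; exact: hm m (leqnn m).
    have [K _ hK] := (cvgrPdist_lt _ _).1 (hcvg w) _ (divr_gt0 e0 (@ltr0Sn R 1)).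
    exists m => //; exists K => // k Kk v /= bv.
    apply: eU; rewrite -ball_normE/=; rewrite -ball_normE/= in bv.
    have := hK k Kk => /= h.
    rewrite -(subrKA (fk k w)); apply: le_lt_trans (ler_normD _ _) _.
    by rewrite [e]splitr ltrD// (lt_trans bv).
  have m0 : 0 < m.+1%:R^-1 :> R by rewrite invr_gt0.
  have [K' _ hK'] := (cvgrPdist_lt _ _).1 (hcvg w) _ m0.
  have := hK (maxn K K') (leq_maxl _ _); apply.
  by rewrite -ball_normE/= distrC; exact: hK' (leq_maxr _ _).
apply: bigcupT_measurable => m; apply: bigcupT_measurable => K.
apply: bigcap_measurable; first by exists K => /=.
by move=> k _; exact: simple_rv_preimage.
Qed.

End BorelMaps.

Arguments borel_space {R} Y.

(** * Integrable real random variables *)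

Section Expectation.
Context {R : realType} {d : measure_display} {T : measurableType d}
  (P : probability T R).
Implicit Types (f g : T -> R) (k : R).

Definition L1 (f : T -> R) := P.-integrable setT (EFin \o f).

Lemma L1_measurable f : L1 f -> measurable_fun setT f.
Proof. by move=> /integrableP[/measurable_EFinP]. Qed.

Lemma L1_cst k : L1 (fun=> k).
Proof. exact: finite_measure_integrable_cst. Qed.

Lemma L1_le f g : measurable_fun setT f -> (forall w, `|f w| <= g w) ->
  L1 g -> L1 f.
Proof.
move=> mf fg; apply: le_integrable => //; first exact/measurable_EFinP.
by move=> w _ /=; rewrite lee_fin (le_trans (fg w))// ler_norm.
Qed.

Lemma L1_bounded f M : measurable_fun setT f -> (forall w, `|f w| <= M) -> L1 f.
Proof. by move=> mf fM; exact: L1_le mf fM (L1_cst M). Qed.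

Lemma L1Z k f : L1 f -> L1 (fun w => k * f w).
Proof.
move=> /(integrableZl measurableT k); apply: eq_integrable => //.
Qed.

Lemma L1D f g : L1 f -> L1 g -> L1 (fun w => f w + g w).
Proof.
by move=> If Ig; have := integrableD measurableT If Ig; apply: eq_integrable.
Qed.

Lemma L1B f g : L1 f -> L1 g -> L1 (fun w => f w - g w).
Proof.
by move=> If Ig; have := integrableB measurableT If Ig; apply: eq_integrable.
Qed.

Lemma L1_norm f : L1 f -> L1 (fun w => `|f w|).
Proof. exact: integrable_norm. Qed.

Lemma L1_sum (I : Type) (s : seq I) (F : I -> T -> R) :
  (forall i, L1 (F i)) -> L1 (fun w => \sum_(i <- s) F i w).
Proof.
move=> IF; elim: s => [|i s ih].
  by under eq_fun do rewrite big_nil; exact: L1_cst.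
by under eq_fun do rewrite big_cons; exact: L1D.
Qed.

Lemma RintegralT_cst k : \int[P]_w k = k.
Proof. by rewrite Rintegral_cst// [X in fine X](probability_setT P) mulr1. Qed.

Lemma Rintegral_sum (I : Type) (s : seq I) (F : I -> T -> R) :
  (forall i, L1 (F i)) ->
  \int[P]_w (\sum_(i <- s) F i w) = \sum_(i <- s) \int[P]_w F i w.
Proof.
move=> IF; elim: s => [|i s ih].
  by rewrite big_nil; under eq_Rintegral do rewrite big_nil; exact: RintegralT_cst.
rewrite big_cons -ih; under eq_Rintegral do rewrite big_cons.
by rewrite RintegralD//; [exact: IF|exact: L1_sum].
Qed.

Lemma Rintegral_EFin f : L1 f -> (\int[P]_w (f w)%:E)%E = (\int[P]_w f w)%:E.
Proof. by move=> If; rewrite /Rintegral fineK//; exact: integrable_fin_num. Qed.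

Lemma L1_superlevel f c : L1 f -> measurable [set w | c <= f w].
Proof.
move=> /L1_measurable mf.
have -> : [set w | c <= f w] = setT `&` f @^-1` `[c, +oo[%classic.
  by rewrite setTI; apply/seteqP; split=> w /=; rewrite in_itv/= andbT.
exact: mf.
Qed.

Lemma markov_L1 f c : 0 < c -> (forall w, 0 <= f w) -> L1 f ->
  (P [set w | (c <= f w)%R] <= (\int[P]_w f w / c)%:E)%E.
Proof.
move=> c0 f0 If.
have mA := L1_superlevel f c If.
rewrite -(fineK (fin_num_measure P _ mA)) lee_fin ler_pdivlMr//.
have -> : fine (P [set w | c <= f w]) = \int[P]_w \1_[set w | c <= f w] w.
  by rewrite /Rintegral integral_indic// setIT.
have I1 := integrable_indic P mA.
rewrite -RintegralZr//; apply: le_Rintegral => //.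
  by have := L1Z c _ I1; apply: eq_integrable => // w _ /=; rewrite mulrC.
move=> w _; rewrite indicE.
by have [/set_mem h|_] := boolP (w \in _); rewrite ?mul1r ?mul0r.
Qed.

Definition same_law (X1 X2 : T -> R) :=
  forall C : set R, measurable C -> P (X1 @^-1` C) = P (X2 @^-1` C).

(** Both sides are integrals of [f] against the common image measure. *)
Lemma same_law_ge0_integral (X1 X2 : T -> R) (f : R -> \bar R) :
  measurable_fun setT X1 -> measurable_fun setT X2 -> same_law X1 X2 ->
  measurable_fun setT f -> (forall r, 0 <= f r)%E ->
  (\int[P]_w f (X1 w) = \int[P]_w f (X2 w))%E.
Proof.
move=> m1 m2 h12 mf f0.
have /= <- := @ge0_integral_pushforward _ _ _ _ _ _ m1 P setT f measurableT mf
  (fun y _ => f0 y).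
have /= <- := @ge0_integral_pushforward _ _ _ _ _ _ m2 P setT f measurableT mf
  (fun y _ => f0 y).
by apply: eq_measure_integral => A mA _; exact: h12.
Qed.

Lemma same_law_L1 (X1 X2 : T -> R) :
  measurable_fun setT X1 -> same_law X1 X2 -> L1 X2 -> L1 X1.
Proof.
move=> m1 h12 I2; have m2 := L1_measurable _ I2.
apply/integrableP; split; first exact/measurable_EFinP.
move/integrableP : I2 => [_]; apply: le_lt_trans.
rewrite le_eqVlt; apply/orP; left; apply/eqP.
apply: (same_law_ge0_integral X1 X2 (fun r => `|r%:E|%E)) => //.
by apply: measurableT_comp => //; exact/measurable_EFinP.
Qed.

Lemma same_law_Rintegral (X1 X2 : T -> R) :
  measurable_fun setT X1 -> same_law X1 X2 -> L1 X2 ->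
  \int[P]_w X1 w = \int[P]_w X2 w.
Proof.
move=> m1 h12 I2; have m2 := L1_measurable _ I2.
have I1 := same_law_L1 _ _ m1 h12 I2.
have mE : measurable_fun setT (@EFin R) by exact/measurable_EFinP.
congr fine.
have /= <- := @integral_pushforward _ _ _ _ _ _ m1 P setT EFin mE I1 measurableT.
have /= <- := @integral_pushforward _ _ _ _ _ _ m2 P setT EFin mE I2 measurableT.
by apply: eq_measure_integral => A mA _; exact: h12.
Qed.

Definition independent2 (X1 X2 : T -> R) :=
  forall C1 C2 : set R, measurable C1 -> measurable C2 ->
    P (X1 @^-1` C1 `&` X2 @^-1` C2) = (P (X1 @^-1` C1) * P (X2 @^-1` C2))%E.

(** The joint law agrees with the product of the marginals on rectangles, hence everywhere by
    uniqueness of the product measure. Tonelli gives integrability and Fubini the factorization. *)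
Lemma independent_product (X1 X2 : T -> R) :
  L1 X1 -> L1 X2 -> independent2 X1 X2 ->
  L1 (fun w => X1 w * X2 w) /\
  \int[P]_w (X1 w * X2 w) = \int[P]_w X1 w * \int[P]_w X2 w.
Proof.
move=> I1 I2 ind.
have m1 := L1_measurable _ I1; have m2 := L1_measurable _ I2.
pose V1 : {RV P >-> R} := HB.pack X1 (isMeasurableFun.Build _ _ _ _ _ m1).
pose V2 : {RV P >-> R} := HB.pack X2 (isMeasurableFun.Build _ _ _ _ _ m2).
have mZ : measurable_fun setT (fun w => (X1 w, X2 w)) by exact: measurable_fun_pair.
pose Z : {RV P >-> (R * R)%type} := HB.pack (fun w => (X1 w, X2 w))
  (isMeasurableFun.Build _ _ _ _ _ mZ).
pose mu1 : probability R R := distribution P V1.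
pose mu2 : probability R R := distribution P V2.
have lawE (f : R * R -> \bar R) :
    (\int[distribution P Z]_p f p = \int[(mu1 \x mu2)]_p f p)%E.
  apply: eq_measure_integral => A mA _; apply/esym.
  by apply: product_measure_unique => // B C mB mC; exact: ind.
pose f (p : R * R) : R := p.1 * p.2.
have mf : measurable_fun setT f by exact: measurable_funM.
have mEf : measurable_fun setT (EFin \o f) by exact/measurable_EFinP.
have int1 : (\int[mu1]_x `|x%:E| = \int[P]_w `|(X1 w)%:E|)%E.
  by rewrite ge0_integral_distribution//; exact: measurableT_comp.
have int2 : (\int[mu2]_x `|x%:E| = \int[P]_w `|(X2 w)%:E|)%E.
  by rewrite ge0_integral_distribution//; exact: measurableT_comp.
have int1oo := elimT (integrableP _ _ _) I1.
have int2oo := elimT (integrableP _ _ _) I2.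
have mabs : measurable_fun setT (fun r : R => `|r%:E|%E).
  by apply: measurableT_comp => //; exact/measurable_EFinP.
have imf : (mu1 \x mu2)%E.-integrable setT (EFin \o f).
  apply/integrable12ltyP => //.
  have inner x : (\int[mu2]_y `|(EFin \o f) (x, y)| =
      `|x%:E| * \int[P]_w `|(X2 w)%:E|)%E.
    rewrite -int2 -ge0_integralZl//.
    by apply: eq_integral => y _; rewrite /f /= normrM EFinM.
  rewrite (eq_integral (fun x : R => `|x%:E| * \int[P]_w `|(X2 w)%:E|)%E); last first.
    by move=> x _; exact: inner.
  rewrite ge0_integralZr//; last exact: integral_ge0.
  rewrite int1 lte_mul_pinfty ?integral_ge0//; last exact: int2oo.2.
  by rewrite ge0_fin_numE ?integral_ge0//; exact: int1oo.2.
have If : L1 (fun w => X1 w * X2 w).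
  apply/integrableP; split; first exact/measurable_EFinP/measurable_funM.
  have /integrableP[_] := imf; apply: le_lt_trans.
  rewrite -lawE ge0_integral_distribution//.
  by apply: measurableT_comp.
split=> //; rewrite {1}/Rintegral.
have e1 : (\int[P]_w (X1 w * X2 w)%:E =
    \int[mu1]_x \int[mu2]_y (EFin \o f) (x, y))%E.
  have /= <- := integral_distribution (X := Z) mEf If.
  by rewrite lawE -(integral12_prod_meas1 imf).
have mE : measurable_fun setT (@EFin R) by exact/measurable_EFinP.
have E1 : (\int[mu1]_x x%:E = (\int[P]_w X1 w)%:E)%E.
  by rewrite -Rintegral_EFin//; exact: (integral_distribution (X := V1) mE I1).
have E2 : (\int[mu2]_x x%:E = (\int[P]_w X2 w)%:E)%E.
  by rewrite -Rintegral_EFin//; exact: (integral_distribution (X := V2) mE I2).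
have J1 : mu1.-integrable setT (@EFin R).
  by apply/integrableP; split=> //; rewrite int1; exact: int1oo.2.
have J2 : mu2.-integrable setT (@EFin R).
  by apply/integrableP; split=> //; rewrite int2; exact: int2oo.2.
rewrite e1 (eq_integral (fun x : R => x%:E * (\int[P]_w X2 w)%:E)%E); last first.
  by move=> x _; rewrite -E2 -integralZl.
by rewrite integralZr// E1 -EFinM.
Qed.

End Expectation.

(** * Measurability and means of inner products *)

Section StrongMeasurability.
Context {R : realType} {d : measure_display} {T : measurableType d}
  {Y : normedModType R}.

Lemma simple_rvB (f g : T -> Y) (s t : seq Y) :
  simple_rv f s -> simple_rv g t ->
  simple_rv (fun w => f w - g w) [seq a - b | a <- s, b <- t].
Proof.
move=> hf hg; split=> [w|v]; first by apply: allpairs_f; [exact: hf.1|exact: hg.1].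
have -> : (fun w => f w - g w) @^-1` [set v] =
    \bigcup_(a in [set` s]) (f @^-1` [set a] `&` g @^-1` [set a - v]).
  apply/seteqP; split=> w /=.
    by move=> <-; exists (f w); [exact: hf.1|rewrite /= subKr].
  by move=> [a _ [/= -> ->]]; rewrite subKr.
apply: fin_bigcup_measurable => [|a _]; first exact: finite_seq.
by apply: measurableI; [exact: hf.2|exact: hg.2].
Qed.

Lemma strongly_measurableB (f g : T -> Y) :
  strongly_measurable f -> strongly_measurable g ->
  strongly_measurable (fun w => f w - g w).
Proof.
move=> [fk [sk [hf cf]]] [gk [tk [hg cg]]].
exists (fun k w => fk k w - gk k w), (fun k => [seq a - b | a <- sk k, b <- tk k]).
by split=> [k|w]; [exact: simple_rvB|apply: cvgB].
Qed.

Lemma simple_rv_strongly_measurable (f : T -> Y) s :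
  simple_rv f s -> strongly_measurable f.
Proof.
by move=> fs; exists (fun=> f), (fun=> s); split=> // w; exact: cvg_cst.
Qed.

Lemma strongly_measurable_cst (a : Y) : strongly_measurable (fun _ : T => a).
Proof.
apply: (@simple_rv_strongly_measurable _ [:: a]); split=> [w|v].
  by rewrite mem_seq1.
by rewrite preimage_cst; case: ifP => _.
Qed.

Lemma borel_dist (b : Y) : measurable_fun setT (fun v : borel_space Y => `|v - b|).
Proof.
apply: continuous_borel => v; apply: cvg_norm; apply: cvgB; first exact: cvg_id.
exact: cvg_cst.
Qed.

Lemma strongly_measurable_norm (f : T -> Y) :
  strongly_measurable f -> measurable_fun setT (fun w => `|f w|).
Proof.
move=> /strongly_measurable_borel mf.
have := measurableT_comp (borel_dist 0) mf.
by apply: eq_measurable_fun => w _ /=; rewrite subr0.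
Qed.

(** The sequence enumerates all values of the simple approximants, coding pairs of an approximant
    and a position in its list by integers. *)
Lemma countable_range (f : T -> Y) : strongly_measurable f ->
  exists a : nat -> Y, forall w e, 0 < e -> exists k, `|f w - a k| < e.
Proof.
move=> [fk [sk [hf cf]]].
exists (fun n => let p := odflt (0%N, 0%N) (unpickle n) in nth 0 (sk p.1) p.2).
move=> w e e0; have [K _ hK] := (cvgrPdist_lt _ _).1 (cf w) _ e0.
exists (pickle (K, index (fk K w) (sk K))); rewrite pickleK /=.
by rewrite nth_index; [exact: hK (leqnn K)|exact: (hf K).1].
Qed.

Context {ip : Y -> Y -> R}.
Hypothesis hip : is_inner_product ip.

(** Reduces the measurability of inner products to that of norms. *)
Lemma polarization u v : ip u v = 2^-1 * (`|u| ^+ 2 + `|v| ^+ 2 - `|u - v| ^+ 2).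
Proof. by rewrite (normB_sqr hip); field. Qed.

Lemma strongly_measurable_ip (f g : T -> Y) :
  strongly_measurable f -> strongly_measurable g ->
  measurable_fun setT (fun w => ip (f w) (g w)).
Proof.
move=> mf mg; under eq_fun do rewrite polarization.
apply: measurable_funM => //; apply: measurable_funB.
  by apply: measurable_funD; apply: measurable_funX; exact: strongly_measurable_norm.
by apply: measurable_funX; apply: strongly_measurable_norm; exact: strongly_measurableB.
Qed.

Lemma borel_ip (b a : Y) :
  measurable_fun setT (fun v : borel_space Y => ip (v - b) a).
Proof.
have -> : (fun v : borel_space Y => ip (v - b) a) = fun v : borel_space Y =>
    2^-1 * (`|v - b| ^+ 2 + `|a| ^+ 2 - `|v - (b + a)| ^+ 2).
  by apply/funext => v; rewrite polarization opprD addrA.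
apply: measurable_funM => //; apply: measurable_funB.
  by apply: measurable_funD => //; apply: measurable_funX; exact: borel_dist.
by apply: measurable_funX; exact: borel_dist.
Qed.

Lemma simple_mean_ip (P : probability T R) (f : T -> Y) s a : simple_rv f s ->
  L1 P (fun w => ip (f w) a) /\
  ip (simple_mean P f s) a = \int[P]_w ip (f w) a.
Proof.
move=> hf.
(* Each value occurs once in [undup s], so that only the summand [v = f w] survives. *)
have fE w : ip (f w) a = \sum_(v <- undup s) ip v a * \1_(f @^-1` [set v]) w.
  have fs : f w \in undup s by rewrite mem_undup; exact: hf.1.
  rewrite (bigD1_seq (f w)) ?undup_uniq//= indicE mem_set// mulr1 big1 ?addr0//.
  by move=> v vf; rewrite indicE memNset ?mulr0//= => fv; rewrite fv eqxx in vf.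
have I1 v : L1 P (fun w => ip v a * \1_(f @^-1` [set v]) w).
  by apply: L1Z; apply: integrable_indic; exact: hf.2.
split; first by under eq_fun do rewrite fE; exact: L1_sum.
under eq_Rintegral do rewrite fE.
rewrite Rintegral_sum// /simple_mean (ip_suml hip); apply: eq_bigr => v _.
rewrite (ipZl hip) mulrC RintegralZl//; last first.
  by apply: integrable_indic; exact: hf.2.
by rewrite /Rintegral integral_indic ?setIT//; exact: hf.2.
Qed.

(** Pairing with [a] is Lipschitz, so the identity passes from the simple approximants to the limit,
    with the error estimated in [bound]. *)
Lemma bochner_mean_ip (P : probability T R) (f : T -> Y) m a :
  strongly_measurable f -> L1 P (fun w => `|f w|) -> bochner_mean P f m ->
  L1 P (fun w => ip (f w) a) /\ \int[P]_w ip (f w) a = ip m a.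
Proof.
move=> mf If [fk [sk [hs herr hmean]]].
have Iip : L1 P (fun w => ip (f w) a).
  apply: (@L1_le _ _ _ _ _ (fun w => `|a| * `|f w|)); last exact: L1Z.
    by apply: strongly_measurable_ip => //; exact: strongly_measurable_cst.
  by move=> w; rewrite mulrC; exact: cauchy_schwarz.
split=> //.
have Ierr k : L1 P (fun w => `|fk k w - f w|).
  apply: (@L1_le _ _ _ _ _ (fun w => \sum_(v <- sk k) `|v| + `|f w|)).
  - apply: strongly_measurable_norm; apply: strongly_measurableB => //.
    exact: simple_rv_strongly_measurable (hs k).
  - move=> w; rewrite normr_id; apply: le_trans (ler_normB _ _) _.
    rewrite lerD2r (big_rem (fk k w)) ?(hs k).1//= lerDl.
    exact: sumr_ge0.
  - by apply: L1D => //; exact: L1_cst.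
have bound k : `|\int[P]_w ip (f w) a - ip m a| <=
    `|a| * (\int[P]_w `|fk k w - f w| + `|simple_mean P (fk k) (sk k) - m|).
  have [Ik mk] := simple_mean_ip P _ _ a (hs k).
  rewrite -(subrKA (ip (simple_mean P (fk k) (sk k)) a)).
  apply: le_trans (ler_normD _ _) _; rewrite mulrDr; apply: lerD; last first.
    by rewrite -(ipBl hip) mulrC; exact: cauchy_schwarz.
  rewrite mk -RintegralB//; apply: le_trans.
    by apply: le_normr_Rintegral => //; exact: L1B.
  rewrite -RintegralZl//; last exact: Ierr.
  apply: le_Rintegral => //.
  - by apply: L1_norm; exact: L1B.
  - exact: L1Z.
  - by move=> w _; rewrite -(ipBl hip) mulrC [`|fk k w - _|]distrC; exact: cauchy_schwarz.
apply/eqP; rewrite -subr_eq0 -normr_le0; apply/ler_addgt0Pr => e e0; rewrite add0r.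
have e1 : 0 < e / (2 * (`|a| + 1)) by rewrite divr_gt0// mulr_gt0// ltr_wpDl.
have [K1 _ h1] := (cvgrPdist_lt _ _).1 hmean _ e1.
have herr' : (fun k => \int[P]_w `|fk k w - f w|) @ \oo --> (0 : R).
  by apply: (@fine_cvg _ _ _ _ _ 0).
have [K2 _ h2] := (cvgrPdist_lt _ _).1 herr' _ e1.
pose k := maxn K1 K2.
have {}h1 := h1 k (leq_maxl _ _); have {}h2 := h2 k (leq_maxr _ _).
apply: le_trans (bound k) _; rewrite /= distrC in h1.
rewrite /= sub0r normrN ger0_norm ?Rintegral_ge0// in h2.
have -> : e = (`|a| + 1) * (e / (2 * (`|a| + 1)) + e / (2 * (`|a| + 1))).
  by field; rewrite gt_eqF// ltr_wpDl.
by apply: ler_pM => //; rewrite ?addr_ge0 ?Rintegral_ge0 ?lerDl// lerD// ltW.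
Qed.

End StrongMeasurability.

(** * Concentration of the sample mean and standard deviation *)

Section IIDSample.
Context {R : realType} {d : measure_display} {T : measurableType d}
  {P : probability T R} {Y : normedModType R} {ip : Y -> Y -> R}.
Hypothesis hip : is_inner_product ip.
Context {ys : nat -> T -> Y} {y : Y} {sigma : R}.
Hypothesis hysrv : forall i, strongly_measurable (ys i).
Hypothesis hysind : mutually_independent P ys.
Hypothesis hysid : identically_distributed P ys.
Hypothesis hmean : bochner_mean P (ys 0%N) y.
Hypothesis hvar : (\int[P]_w (`|ys 0%N w - y| ^+ 2)%:E)%E = (sigma ^+ 2)%:E.

Lemma iid_measurable (f : borel_space Y -> R) i :
  measurable_fun setT f -> measurable_fun setT (fun w => f (ys i w)).
Proof.
by move=> mf; exact: measurableT_comp mf (strongly_measurable_borel _ (hysrv i)).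
Qed.

Lemma iid_same_law (f : borel_space Y -> R) i : measurable_fun setT f ->
  same_law P (fun w => f (ys i w)) (fun w => f (ys 0%N w)).
Proof.
move=> mf C mC; apply: (hysid i (f @^-1` C)).
by have := mf measurableT C mC; rewrite setTI.
Qed.

Lemma iid_L1 (f : borel_space Y -> R) i : measurable_fun setT f ->
  L1 P (fun w => f (ys 0%N w)) -> L1 P (fun w => f (ys i w)).
Proof.
by move=> mf; apply: same_law_L1; [exact: iid_measurable|exact: iid_same_law].
Qed.

Lemma iid_Rintegral (f : borel_space Y -> R) i : measurable_fun setT f ->
  L1 P (fun w => f (ys 0%N w)) -> \int[P]_w f (ys i w) = \int[P]_w f (ys 0%N w).
Proof.
by move=> mf; apply: same_law_Rintegral; [exact: iid_measurable|exact: iid_same_law].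
Qed.

Lemma iid_independent (f g : borel_space Y -> R) i j : i != j ->
  measurable_fun setT f -> measurable_fun setT g ->
  independent2 P (fun w => f (ys i w)) (fun w => g (ys j w)).
Proof.
move=> ij mf mg C1 C2 mC1 mC2.
(* Every index other than [i], in particular [j], receives the second set. *)
pose B k : set Y := if k == i then f @^-1` C1 else g @^-1` C2.
have := hysind [:: i; j] B.
rewrite /= mem_seq1 ij /= => /(_ erefl) h.
have {}h : P (\bigcap_(k in [set` [:: i; j]]) (ys k @^-1` B k)) =
    (\prod_(k <- [:: i; j]) P (ys k @^-1` B k))%E.
  apply: h => k _; rewrite /B; case: ifP => _.
    by have := mf measurableT C1 mC1; rewrite setTI.
  by have := mg measurableT C2 mC2; rewrite setTI.
move: h; rewrite !big_cons big_nil mule1 /B eqxx [j == i]eq_sym (negbTE ij) => <-.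
congr (P _); apply/seteqP; split=> w /=.
  move=> [h1 h2] k /=; rewrite !inE => /orP[] /eqP ->; rewrite ?eqxx//.
  by rewrite [j == i]eq_sym (negbTE ij).
move=> h; split; first by have := h i; rewrite /= !inE eqxx/=; apply.
have := h j; rewrite /= !inE eqxx orbT /= [j == i]eq_sym (negbTE ij); exact.
Qed.

Let borel_dist2 : measurable_fun setT (fun v : borel_space Y => `|v - y| ^+ 2).
Proof. by apply: measurable_funX; exact: borel_dist. Qed.

Lemma sqr_dist_L1 i : L1 P (fun w => `|ys i w - y| ^+ 2).
Proof.
apply: (iid_L1 (fun v => `|v - y| ^+ 2)) => //.
apply/integrableP; split.
  by apply/measurable_EFinP; exact: (iid_measurable (fun v => `|v - y| ^+ 2)).
under eq_integral do rewrite /= ger0_norm ?sqr_ge0//.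
by rewrite hvar ltry.
Qed.

Lemma Rintegral_sqr_dist i : \int[P]_w (`|ys i w - y| ^+ 2) = sigma ^+ 2.
Proof.
rewrite (iid_Rintegral (fun v => `|v - y| ^+ 2))//; last exact: sqr_dist_L1.
by rewrite /Rintegral hvar.
Qed.

Lemma dist_L1 i : L1 P (fun w => `|ys i w - y|).
Proof.
apply: (@L1_le _ _ _ _ _ (fun w => 1 + `|ys i w - y| ^+ 2)).
- by apply: (iid_measurable (fun v => `|v - y|)); exact: borel_dist.
- move=> w; rewrite normr_id; have := sqr_ge0 (`|ys i w - y| - 1).
  have := sqr_ge0 `|ys i w - y|; lra.
- by apply: L1D; [exact: L1_cst|exact: sqr_dist_L1].
Qed.

Lemma centered_ip_mean i a : L1 P (fun w => ip (ys i w - y) a) /\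
  \int[P]_w ip (ys i w - y) a = 0.
Proof.
have I0 : L1 P (fun w => `|ys 0%N w|).
  apply: (@L1_le _ _ _ _ _ (fun w => `|ys 0%N w - y| + `|y|)).
  - exact: strongly_measurable_norm.
  - by move=> w; rewrite normr_id -{1}(subrK y (ys 0%N w)) ler_normD.
  - by apply: L1D; [exact: dist_L1|exact: L1_cst].
have [I1 E1] := bochner_mean_ip hip P _ _ a (hysrv 0%N) I0 hmean.
have I2 : L1 P (fun w => ip (ys 0%N w - y) a).
  under eq_fun do rewrite (ipBl hip).
  by apply: L1B => //; exact: L1_cst.
have mb := borel_ip hip y a.
split; first exact: (iid_L1 (fun v => ip (v - y) a)).
rewrite (iid_Rintegral (fun v => ip (v - y) a))//.
under eq_Rintegral do rewrite (ipBl hip).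
by rewrite RintegralB// ?RintegralT_cst ?E1 ?subrr//; exact: L1_cst.
Qed.

Lemma centered_ip_L1 i j : L1 P (fun w => ip (ys i w - y) (ys j w - y)).
Proof.
apply: (@L1_le _ _ _ _ _ (fun w => `|ys i w - y| ^+ 2 + `|ys j w - y| ^+ 2)).
- apply: strongly_measurable_ip => //.
    by apply: strongly_measurableB => //; exact: strongly_measurable_cst.
  by apply: strongly_measurableB => //; exact: strongly_measurable_cst.
- move=> w; apply: le_trans (cauchy_schwarz hip _ _) _.
  have := sqr_ge0 (`|ys i w - y| - `|ys j w - y|).
  have := sqr_ge0 (`|ys i w - y|); have := sqr_ge0 (`|ys j w - y|); lra.
- by apply: L1D; exact: sqr_dist_L1.
Qed.

(* The second factor is replaced by a function of it with finitely many values: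
   on the part of the first [N] balls of radius [e] around a dense sequence
   not covered before, it is replaced by the centre. *)
Lemma centered_ip_uncorrelated i j : i != j ->
  \int[P]_w ip (ys i w - y) (ys j w - y) = 0.
Proof.
move=> ij.
have [a ha] := countable_range _ (hysrv j).
suff small e : 0 < e ->
    `|\int[P]_w ip (ys i w - y) (ys j w - y)| <= e * \int[P]_w `|ys i w - y|.
  apply/eqP; rewrite -normr_le0; apply/ler_addgt0Pr => e e0; rewrite add0r.
  set m := \int[P]_w `|ys i w - y| in small.
  have m0 : 0 <= m by exact: Rintegral_ge0.
  have m1 : 0 < m + 1 by rewrite ltr_wpDl.
  apply: le_trans (small (e / (m + 1)) _) _; first by rewrite divr_gt0.
  by rewrite -mulrA ler_piMr// ?(ltW e0)// mulrC ler_pdivrMr// mul1r lerDl.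
move=> e0.
pose D N : set Y := \bigcup_(k in `I_N) [set v | `|v - a k| < e].
have mD N : measurable (D N : set (borel_space Y)).
  apply: bigcup_measurable => k _.
  have -> : [set v | `|v - a k| < e] = setT `&` (fun v : borel_space Y => `|v - a k|)
      @^-1` `]-oo, e[%classic.
    by rewrite setTI; apply/seteqP; split=> v /=; rewrite in_itv.
  exact: borel_dist.
pose c k (v : Y) : R := \1_(D k.+1) v - \1_(D k) v.
have mc k : measurable_fun setT (c k : borel_space Y -> R).
  by apply: measurable_funB; exact: measurable_indic.
have DS k : D k `<=` D k.+1.
  by move=> v [l lk vl]; exists l => //=; exact: ltnW.
have c_cases k v : c k v = 0 \/ (c k v = 1 /\ `|v - a k| < e).
  rewrite /c !indicE; have [vD|vD] := boolP (v \in D k).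
    by left; rewrite mem_set ?subrr//; apply: DS; exact: set_mem.
  have [/set_mem [l /= lk vl]|_] := boolP (v \in D k.+1); last by left; rewrite subrr.
  right; rewrite subr0; split=> //.
  move: lk; rewrite ltnS leq_eqVlt => /orP[/eqP <-//|lk].
  by case/negP: vD; apply/mem_set; exists l.
have c_sum N v : \sum_(k < N) c k v = \1_(D N) v :> R.
  rewrite -(big_mkord xpredT (fun k => c k v)) telescope_sumr//.
  by rewrite [X in _ - X](_ : _ = 0) ?subr0// indicE memNset// => -[].
pose U w := ys i w - y; pose V w := ys j w - y.
(* [I N] restricts to the event that the first [N] balls contain [ys j]; [J N] puts the centres in
   place of [ys j] there, an error of at most [e |U|]. *)
pose I N w : R := \1_(D N) (ys j w) * ip (U w) (V w).
pose J N w : R := \sum_(k < N) (ip (U w) (a k - y) * c k (ys j w)).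
have mDj N : measurable_fun setT (fun w => \1_(D N) (ys j w) : R).
  by apply: (iid_measurable (\1_(D N))); exact: measurable_indic.
have indic01 N w : `|\1_(D N) (ys j w) : R| <= 1.
  by rewrite indicE; case: (_ \in _); rewrite ?normr1 ?normr0.
have mip : measurable_fun setT (fun w => ip (U w) (V w)).
  exact: L1_measurable _ _ (centered_ip_L1 i j).
have I_L1 N : L1 P (I N).
  apply: (@L1_le _ _ _ _ _ (fun w => `|ip (U w) (V w)|)).
  - exact: measurable_funM.
  - by move=> w; rewrite normrM ler_piMl.
  - by apply: L1_norm; exact: centered_ip_L1.
(* Now [ys j] enters through a real function only: independence factors the mean, and the centred
   factor has mean zero. *)
have term k : L1 P (fun w => ip (U w) (a k - y) * c k (ys j w)) /\
    \int[P]_w (ip (U w) (a k - y) * c k (ys j w)) = 0.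
  have [Ia Ea] := centered_ip_mean i (a k - y).
  have Ic : L1 P (fun w => c k (ys j w)).
    apply: (@L1_bounded _ _ _ _ _ 1); first exact: (iid_measurable (c k)).
    by move=> w; case: (c_cases k (ys j w)) => [->|[-> _]]; rewrite ?normr0 ?normr1.
  have [IM EM] := independent_product P _ _ Ia Ic
    (iid_independent (fun v => ip (v - y) (a k - y)) (c k) i j ij (borel_ip hip _ _) (mc k)).
  by split=> //; rewrite EM Ea mul0r.
have J_L1 N : L1 P (J N) by apply: L1_sum => k; case: (term k).
have EJ N : \int[P]_w J N w = 0.
  rewrite Rintegral_sum => [|k]; last by case: (term k).
  by rewrite big1// => k _; case: (term k).
have EI N : `|\int[P]_w I N w| <= e * \int[P]_w `|U w|.
  rewrite -[\int[P]_w I N w]subr0 -(EJ N) -RintegralB//; [|exact: I_L1|exact: J_L1].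
  apply: le_trans.
    by apply: le_normr_Rintegral => //; apply: L1B; [exact: I_L1|exact: J_L1].
  rewrite -RintegralZl//; last exact: dist_L1.
  apply: le_Rintegral => //.
  - by apply: L1_norm; apply: L1B; [exact: I_L1|exact: J_L1].
  - by apply: L1Z; exact: dist_L1.
  - move=> w _; rewrite /I /J -c_sum mulr_suml -sumrB.
    apply: le_trans (ler_norm_sum _ _ _) _.
    apply: (@le_trans _ _ (\sum_(k < N) c k (ys j w) * (e * `|U w|))).
      apply: ler_sum => k _; rewrite mulrC -mulrBl -(ipBr hip).
      rewrite /V opprB addrA subrK.
      case: (c_cases k (ys j w)) => [->|[-> hlt]]; first by rewrite mulr0 normr0 mul0r.
      rewrite mulr1 mul1r; apply: le_trans (cauchy_schwarz hip _ _) _.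
      by rewrite mulrC ler_wpM2r// ltW.
    by rewrite -mulr_suml c_sum ler_piMl ?mulr_ge0 ?(ltW e0).
(* The balls cover the range of [ys j], so dominated convergence removes the restriction. *)
have cvgI : (fun N => \int[P]_w I N w) @ \oo --> \int[P]_w ip (U w) (V w).
  have ptwise : {ae P, forall w, setT w ->
      (EFin \o I N) w @[N --> \oo] --> (ip (U w) (V w))%:E}.
    apply: aeW => w _; apply: cvg_near_cst; have [k hk] := ha w e e0.
    exists k.+1 => // N /= kN; rewrite /I indicE mem_set ?mul1r//.
    by exists k.
  have dom_ip : {ae P, forall w N, setT w ->
      (`|(EFin \o I N) w| <= (`|ip (U w) (V w)|)%:E)%E}.
    by apply: aeW => w N _; rewrite /= lee_fin normrM ler_piMl.
  have [_ _ h] := dominated_convergence measurableT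
    (fun N => measurable_int _ (I_L1 N)) (measurable_int _ (centered_ip_L1 i j))
    ptwise (L1_norm _ _ (centered_ip_L1 i j)) dom_ip.
  by apply: fine_cvg; rewrite -(Rintegral_EFin _ _ (centered_ip_L1 i j)).
by apply: cvgr_to_le (cvg_norm cvgI) _; exact: nearW.
Qed.

(** Only the diagonal contributes to the mean. This serves both the vector sum and the sum of
    truncated distances. *)
Lemma orthogonal_sum_mean (G : nat -> nat -> T -> R) v n :
  (forall i j, L1 P (G i j)) ->
  (forall i j, i != j -> \int[P]_w G i j w = 0) ->
  (forall i, \int[P]_w G i i w <= v) ->
  L1 P (fun w => \sum_(i < n) \sum_(j < n) G i j w) /\
  \int[P]_w (\sum_(i < n) \sum_(j < n) G i j w) <= n%:R * v.
Proof.
move=> IG G0 Gv.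
have IGi i : L1 P (fun w => \sum_(j < n) G i j w) by exact: L1_sum.
split; first by apply: L1_sum => i; exact: IGi.
rewrite Rintegral_sum => [|i]; last exact: IGi.
rewrite -[n in n%:R]card_ord mulrC mulr_natr -sumr_const; apply: ler_sum => i _.
rewrite Rintegral_sum// (bigD1 i)//= big1 ?addr0// => j ji.
by apply: G0; rewrite eq_sym.
Qed.

Lemma sum_dist_mean n :
  L1 P (fun w => `|\sum_(i < n) (ys i w - y)| ^+ 2) /\
  \int[P]_w (`|\sum_(i < n) (ys i w - y)| ^+ 2) <= n%:R * sigma ^+ 2.
Proof.
have -> : (fun w => `|\sum_(i < n) (ys i w - y)| ^+ 2) =
    fun w => \sum_(i < n) \sum_(j < n) ip (ys i w - y) (ys j w - y).
  apply/funext => w; rewrite -(ip_norm hip) (ip_suml hip).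
  by apply: eq_bigr => i _; rewrite (ip_sumr hip).
apply: (orthogonal_sum_mean (fun i j w => ip (ys i w - y) (ys j w - y))).
- exact: centered_ip_L1.
- exact: centered_ip_uncorrelated.
- move=> i; under eq_Rintegral do rewrite (ip_norm hip).
  by rewrite Rintegral_sqr_dist.
Qed.

(** Squared distances may have infinite variance; truncated at [m] they are bounded, and Chebyshev's
    inequality applies. *)
Let trunc (m : nat) (v : Y) := Num.min (`|v - y| ^+ 2) m%:R.

Let borel_trunc m : measurable_fun setT (trunc m : borel_space Y -> R).
Proof. by apply: measurable_minr => //; exact: borel_dist2. Qed.

Let trunc_ge0 m v : 0 <= trunc m v.
Proof. by rewrite le_min sqr_ge0 ler0n. Qed.

Let trunc_le m v : trunc m v <= m%:R.
Proof. by rewrite ge_min lexx orbT. Qed.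

Let trunc_le_sqr m v : trunc m v <= `|v - y| ^+ 2.
Proof. by rewrite ge_min lexx. Qed.

Lemma trunc_L1 m i : L1 P (fun w => trunc m (ys i w)).
Proof.
apply: (@L1_bounded _ _ _ _ _ m%:R); first exact: (iid_measurable (trunc m)).
by move=> w; rewrite ger0_norm.
Qed.

Lemma trunc_mean_cvg :
  (fun m => \int[P]_w trunc m (ys 0%N w)) @ \oo --> sigma ^+ 2.
Proof.
have ptwise : {ae P, forall w, setT w ->
    (trunc m (ys 0%N w))%:E @[m --> \oo] --> (`|ys 0%N w - y| ^+ 2)%:E}.
  apply: aeW => w _; apply: cvg_near_cst.
  have [k _ hk] := nbhs_infty_ger (`|ys 0%N w - y| ^+ 2).
  exists k => // m /hk hm; congr EFin; exact/min_idPl.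
have dom_tr : {ae P, forall w m, setT w ->
    (`|(trunc m (ys 0%N w))%:E| <= (`|ys 0%N w - y| ^+ 2)%:E)%E}.
  by apply: aeW => w m _; rewrite /= lee_fin ger0_norm.
have [_ _ h] := dominated_convergence measurableT
  (fun m => measurable_int _ (trunc_L1 m 0%N)) (measurable_int _ (sqr_dist_L1 0%N))
  ptwise (sqr_dist_L1 0%N) dom_tr.
by apply: fine_cvg; rewrite -hvar.
Qed.

Lemma trunc_sum_variance m n (w0 := \int[P]_w trunc m (ys 0%N w)) :
  L1 P (fun w => (\sum_(i < n) (trunc m (ys i w) - w0)) ^+ 2) /\
  \int[P]_w ((\sum_(i < n) (trunc m (ys i w) - w0)) ^+ 2) <= n%:R * m%:R ^+ 2.
Proof.
have -> : (fun w => (\sum_(i < n) (trunc m (ys i w) - w0)) ^+ 2) =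
    fun w => \sum_(i < n) \sum_(j < n)
      (trunc m (ys i w) - w0) * (trunc m (ys j w) - w0).
  apply/funext => w; rewrite expr2 mulr_suml.
  by apply: eq_bigr => i _; rewrite mulr_sumr.
have w00 : 0 <= w0 by exact: Rintegral_ge0.
have w0m : w0 <= m%:R.
  rewrite -[leRHS](RintegralT_cst P); apply: le_Rintegral => //; first exact: trunc_L1.
  exact: L1_cst.
have cbound i w : `|trunc m (ys i w) - w0| <= m%:R.
  have := trunc_ge0 m (ys i w); have := trunc_le m (ys i w).
  by move=> ? ?; rewrite ler_norml; apply/andP; split; lra.
have mc : measurable_fun setT (fun v : borel_space Y => trunc m v - w0).
  exact: measurable_funB.
have Ic i : L1 P (fun w => trunc m (ys i w) - w0).
  by apply: L1B; [exact: trunc_L1|exact: L1_cst].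
have Ec i : \int[P]_w (trunc m (ys i w) - w0) = 0.
  rewrite RintegralB// ?RintegralT_cst; [|exact: trunc_L1|exact: L1_cst].
  by rewrite (iid_Rintegral (trunc m))// ?subrr//; exact: trunc_L1.
have prod_bound i j w :
    `|(trunc m (ys i w) - w0) * (trunc m (ys j w) - w0)| <= m%:R ^+ 2.
  by rewrite normrM expr2 ler_pM.
have Iprod i j : L1 P (fun w => (trunc m (ys i w) - w0) * (trunc m (ys j w) - w0)).
  apply: (L1_bounded _ _ (m%:R ^+ 2)) => //.
  by apply: measurable_funM; exact: L1_measurable (Ic _).
apply: (orthogonal_sum_mean
  (fun i j w => (trunc m (ys i w) - w0) * (trunc m (ys j w) - w0))) => //.
- move=> i j ij.
  have [_ ->] := independent_product P _ _ (Ic i) (Ic j)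
    (iid_independent (fun v => trunc m v - w0) (fun v => trunc m v - w0) i j ij mc mc).
  by rewrite Ec mul0r.
- move=> i; rewrite -[leRHS](RintegralT_cst P); apply: le_Rintegral => //.
  - exact: Iprod.
  - exact: L1_cst.
  - by move=> w _; apply: le_trans (ler_norm _) _.
Qed.

(** The part above the truncation is nonnegative, so its mean controls it through Markov's
    inequality. *)
Lemma trunc_rest_mean m n :
  L1 P (fun w => \sum_(i < n) (`|ys i w - y| ^+ 2 - trunc m (ys i w))) /\
  \int[P]_w (\sum_(i < n) (`|ys i w - y| ^+ 2 - trunc m (ys i w))) =
    n%:R * (sigma ^+ 2 - \int[P]_w trunc m (ys 0%N w)).
Proof.
have I1 i : L1 P (fun w => `|ys i w - y| ^+ 2 - trunc m (ys i w)).
  by apply: L1B; [exact: sqr_dist_L1|exact: trunc_L1].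
split; first exact: L1_sum.
rewrite Rintegral_sum// -[n in n%:R]card_ord [RHS]mulrC mulr_natr -sumr_const.
apply: eq_bigr => i _.
rewrite RintegralB//; [|exact: sqr_dist_L1|exact: trunc_L1].
by rewrite Rintegral_sqr_dist (iid_Rintegral (trunc m))//; exact: trunc_L1.
Qed.

Lemma sample_meanB n w : (0 < n)%N ->
  \sum_(i < n) (ys i w - y) = n%:R *: (sample_mean ys n w - y).
Proof.
move=> n0; rewrite sumrB sumr_const card_ord scalerBr (scaler_nat n y) /sample_mean.
by rewrite scalerA divff ?scale1r// pnatr_eq0 -lt0n.
Qed.

(** Expanding around [y], the cross terms add up to [- 2 n |D|^2] and the constant terms to
    [n |D|^2]. *)
Lemma sum_sqr_sample_mean n w : (0 < n)%N ->
  \sum_(i < n) `|ys i w - sample_mean ys n w| ^+ 2 =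
  \sum_(i < n) `|ys i w - y| ^+ 2 - n%:R * `|sample_mean ys n w - y| ^+ 2.
Proof.
move=> n0; set D := sample_mean ys n w - y.
have -> : \sum_(i < n) `|ys i w - sample_mean ys n w| ^+ 2 =
    \sum_(i < n) (`|ys i w - y| ^+ 2 - 2 * ip (ys i w - y) D + `|D| ^+ 2).
  apply: eq_bigr => i _; rewrite -(normB_sqr hip) /D opprB addrA subrK //.
rewrite big_split/= sumrB -mulr_sumr -(ip_suml hip) sample_meanB// -/D.
by rewrite (ipZl hip) (ip_norm hip) sumr_const card_ord -mulr_natl; ring.
Qed.

(** The factor [n / (n - 1)] lies between 1 and 2, and the squared error of the sample mean takes
    away at most [sigma^2 / 4]. *)
Lemma sample_sd_bounds n w (delta : R) : (1 < n)%N -> 0 < sigma ->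
  `|sample_mean ys n w - y| <= delta -> 4 * delta ^+ 2 <= sigma ^+ 2 ->
  n%:R * (sigma ^+ 2 / 2) <= \sum_(i < n) `|ys i w - y| ^+ 2 ->
  \sum_(i < n) `|ys i w - y| ^+ 2 <= n%:R * (2 * sigma ^+ 2) ->
  sigma / 2 <= sample_sd ys n w <= 2 * sigma.
Proof.
move=> n1 s0 hd hs lo hi.
have n0 : (0 < n)%N by exact: ltnW.
have d0 : 0 <= delta by apply: le_trans hd.
have d2 : `|sample_mean ys n w - y| ^+ 2 <= delta ^+ 2 by rewrite ler_pXn2r ?nnegrE.
have p0 : 0 < n.-1%:R :> R by rewrite ltr0n -subn1 subn_gt0.
have np : n%:R = n.-1%:R + 1 :> R by rewrite natr1 prednK.
have p1 : 1 <= n.-1%:R :> R by rewrite ler1n -subn1 subn_gt0.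
rewrite /sample_sd sum_sqr_sample_mean//.
set V := (X in Num.sqrt X).
have V1 : V <= (2 * sigma) ^+ 2.
  rewrite /V [_^-1 * _]mulrC ler_pdivrMr//.
  have : 0 <= n%:R * `|sample_mean ys n w - y| ^+ 2 by rewrite mulr_ge0 ?sqr_ge0.
  have : 0 <= sigma ^+ 2 * (n.-1%:R - 1) by rewrite mulr_ge0 ?sqr_ge0// subr_ge0.
  rewrite np in hi *; lra.
have V2 : (sigma / 2) ^+ 2 <= V.
  rewrite /V [_^-1 * _]mulrC ler_pdivlMr//.
  have : n%:R * `|sample_mean ys n w - y| ^+ 2 <= n%:R * (sigma ^+ 2 / 4).
    by rewrite ler_wpM2l//; lra.
  have := sqr_ge0 sigma.
  rewrite np in lo *; lra.
have V0 : 0 <= V by apply: le_trans V2; exact: sqr_ge0.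
apply/andP; split.
- by rewrite -(ler_pXn2r (_ : 0 < 2)%N) ?nnegrE ?sqrtr_ge0 ?divr_ge0 ?(ltW s0)// sqr_sqrtr.
- by rewrite -(ler_pXn2r (_ : 0 < 2)%N) ?nnegrE ?sqrtr_ge0 ?mulr_ge0 ?(ltW s0)// sqr_sqrtr.
Qed.

Lemma sample_concentration (phi : nat -> R) (eps : R) :
  0 < sigma -> 0 < eps ->
  (forall n, (0 < n)%N -> 0 < phi n) ->
  (forall e, 0 < e -> \forall n \near \oo, phi n <= e) ->
  (forall M, \forall n \near \oo, M <= n%:R * phi n ^+ 2) ->
  \forall n \near \oo, exists2 B : set T, measurable B &
    (forall w, B w -> `|sample_mean ys n w - y| <= phi n / 4 /\
                      sigma / 2 <= sample_sd ys n w <= 2 * sigma) /\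
    ((1 - eps)%:E <= P B)%E.
Proof.
move=> s0 eps0 phi0 phi_small nphi_large.
set s2 := sigma ^+ 2; have s20 : 0 < s2 by rewrite exprn_gt0.
(* The first bound keeps the truncated mean within [s2 / 8] of [s2]; the second gives the remainder
   [S3] an exceptional probability of at most [eps / 3]. *)
have e1 : 0 < Num.min (s2 / 8) (eps * s2 / 24) by rewrite lt_min !divr_gt0// mulr_gt0.
have [m0 _ hm] := (cvgrPdist_lt _ _).1 trunc_mean_cvg _ e1.
have {hm} := hm m0 (leqnn m0); set m := m0; set w0 := \int[P]_w _ => hm.
have [hw1 hw2] : `|s2 - w0| < s2 / 8 /\ `|s2 - w0| < eps * s2 / 24.
  by move: hm; rewrite lt_min => /andP.
near=> n.
have n1 : (1 < n)%N by near: n; exact: nbhs_infty_gt.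
have n0 : (0 < n)%N by exact: ltnW.
have nR : 0 < n%:R :> R by rewrite ltr0n.
have p0 := phi0 n n0.
have hphi : phi n <= sigma by near: n; exact: phi_small.
(* This lower bound and the next are what the second-moment estimates for [S1] and [S2] require to
   leave probability [eps / 3] each. *)
have hn1 : 48 * s2 / eps <= n%:R * phi n ^+ 2 by near: n; exact: nphi_large.
have hn2 : 192 * m%:R ^+ 2 / (eps * s2 ^+ 2) <= n%:R by near: n; exact: nbhs_infty_ger.
pose S1 w := `|\sum_(i < n) (ys i w - y)| ^+ 2.
pose S2 w := (\sum_(i < n) (trunc m (ys i w) - w0)) ^+ 2.
pose S3 w := \sum_(i < n) (`|ys i w - y| ^+ 2 - trunc m (ys i w)).
pose c1 := (n%:R * (phi n / 4)) ^+ 2.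
pose c2 := (n%:R * (s2 / 8)) ^+ 2.
pose c3 := n%:R * (s2 / 8).
have c10 : 0 < c1 by rewrite exprn_gt0// mulr_gt0// divr_gt0.
have c20 : 0 < c2 by rewrite exprn_gt0// mulr_gt0// divr_gt0.
have c30 : 0 < c3 by rewrite mulr_gt0// divr_gt0.
have [I1 E1] := sum_dist_mean n.
have [I2 E2] := trunc_sum_variance m n.
have [I3 E3] := trunc_rest_mean m n.
have S30 w : 0 <= S3 w by apply: sumr_ge0 => i _; rewrite subr_ge0.
have P1 : (P [set w | (c1 <= S1 w)%R] <= (eps / 3)%:E)%E.
  apply: le_trans (markov_L1 P S1 _ c10 (fun w => sqr_ge0 _) I1) _.
  rewrite lee_fin ler_pdivrMr//; apply: le_trans E1 _.
  have := hn1; rewrite ler_pdivrMr// => h.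
  have := ler_wpM2l (ltW nR) h; rewrite /c1 -/s2; lra.
have P2 : (P [set w | (c2 <= S2 w)%R] <= (eps / 3)%:E)%E.
  apply: le_trans (markov_L1 P S2 _ c20 (fun w => sqr_ge0 _) I2) _.
  rewrite lee_fin ler_pdivrMr//; apply: le_trans E2 _.
  have := hn2; rewrite ler_pdivrMr ?mulr_gt0 ?exprn_gt0// => h.
  have := ler_wpM2l (ltW nR) h; rewrite /c2; lra.
have P3 : (P [set w | (c3 <= S3 w)%R] <= (eps / 3)%:E)%E.
  apply: le_trans (markov_L1 P S3 _ c30 S30 I3) _.
  rewrite lee_fin ler_pdivrMr// E3 /c3.
  have := ler_wpM2l (ltW nR) (ltW (le_lt_trans (ler_norm _) hw2)); rewrite /s2 -/w0; lra.
have m1 := L1_superlevel P _ c1 I1.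
have m2 := L1_superlevel P _ c2 I2.
have m3 := L1_superlevel P _ c3 I3.
pose N := [set w | c1 <= S1 w] `|` [set w | c2 <= S2 w] `|` [set w | c3 <= S3 w].
have mN : measurable N by apply: measurableU => //; exact: measurableU.
exists (~` N); first exact: measurableC.
split; last first.
  have PN : (P N <= eps%:E)%E.
    have -> : eps%:E = ((eps / 3)%:E + (eps / 3)%:E + (eps / 3)%:E)%E.
      by rewrite -!EFinD; congr EFin; field.
    apply: le_trans (measureU2 _ _ _) _ => //; first exact: measurableU.
    by apply: leeD => //; apply: le_trans (measureU2 _ _ _) _ => //; exact: leeD.
  rewrite probability_setC// EFinB leeD2l// leeN2//.
move=> w /= /not_orP[/not_orP[h1 h2] h3].
have {}h1 : S1 w < c1 by rewrite ltNge; exact/negP.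
have {}h2 : S2 w < c2 by rewrite ltNge; exact/negP.
have {}h3 : S3 w < c3 by rewrite ltNge; exact/negP.
have hmean' : `|sample_mean ys n w - y| <= phi n / 4.
  move: h1; rewrite /S1 /c1 sample_meanB// ltr_pXn2r ?nnegrE ?mulr_ge0 ?divr_ge0 ?(ltW p0)//.
  by rewrite normrZ ger0_norm// ltr_pM2l// => /ltW.
split=> //.
have abs2 : `|\sum_(i < n) (trunc m (ys i w) - w0)| < c3.
  rewrite -(ltr_pXn2r (_ : 0 < 2)%N) ?nnegrE ?(ltW c30)//.
  by rewrite real_normK ?num_real.
(* Outside [N] the three terms put the sum between [3/4] and [11/8] of [n s2]. *)
have sumE : \sum_(i < n) `|ys i w - y| ^+ 2 =
    \sum_(i < n) (trunc m (ys i w) - w0) + n%:R * w0 + S3 w.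
  rewrite /S3 !sumrB sumr_const card_ord -[w0 *+ n]mulr_natl; ring.
move: abs2; rewrite ltr_norml => /andP[lo2 hi2].
have nw1 : n%:R * w0 <= n%:R * (9 / 8 * s2).
  by rewrite ler_wpM2l//; move: hw1; rewrite ltr_norml => /andP[]; lra.
have nw2 : n%:R * (7 / 8 * s2) <= n%:R * w0.
  by rewrite ler_wpM2l//; move: hw1; rewrite ltr_norml => /andP[]; lra.
have ns2 : 0 < n%:R * s2 by rewrite mulr_gt0.
have S3w := S30 w.
apply: (@sample_sd_bounds _ _ (phi n / 4)) => //.
- have : phi n ^+ 2 <= s2 by rewrite ler_pXn2r ?nnegrE// ltW.
  rewrite -/s2; have := sqr_ge0 (phi n); lra.
- rewrite sumE -/s2; rewrite /c3 in lo2 hi2 h3; lra.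
- rewrite sumE -/s2; rewrite /c3 in lo2 hi2 h3; lra.
Unshelve. all: by end_near.
Qed.

End IIDSample.

(** * From fixed samples to the random iteration *)

Theorem theorem3p11
  (R : realType)
  (X : completeNormedModType R)                       (* Banach space *)
  (Y : completeNormedModType R) (ip : Y -> Y -> R)    (* Hilbert space *)
  (hip : is_inner_product ip)
  (A : {linear X -> Y}) (hA : bounded_op A)
  (Rf : X -> \bar R)
  (hRnn : forall x, (0 <= Rf x)%E)
  (hRproper : proper_fun Rf)
  (hRlsc : lower_semicontinuous Rf)
  (c0 : R) (hc0 : 0 < c0) (hRconv : strongly_convex Rf c0)
  (y : Y)
  (hsolv : exists2 x, A x = y & dom Rf x)
  (xdag : X) (hxdagA : A xdag = y) (hxdagdom : dom Rf xdag)
  (hxdagmin : forall x, A x = y -> (Rf xdag <= Rf x)%E)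
  (d : measure_display) (T : measurableType d) (P : probability T R)
  (ys : nat -> T -> Y)                       (* ys i = y_(i+1) *)
  (hysrv : forall i, strongly_measurable (ys i))
  (hysind : mutually_independent P ys)
  (hysid : identically_distributed P ys)
  (hmean : bochner_mean P (ys 0%N) y)
  (sigma : R) (hsigma : 0 < sigma)
  (hvar : (\int[P]_w (`|ys 0%N w - y| ^+ 2)%:E)%E = (sigma ^+ 2)%:E)
  (gamma : R) (hgamma : 0 < gamma) (hgammaA : gamma * opnorm A ^+ 2 < 2 * c0)
  (x : nat -> nat -> T -> X) (lam : nat -> nat -> T -> Y)
  (hlam0 : forall n w, lam n 0%N w = 0)
  (hx : forall n t w z,
     (Rf (x n t w) - (ip (lam n t w) (A (x n t w)))%:E
        <= Rf z - (ip (lam n t w) (A z))%:E)%E)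
  (hlam : forall n t w,
     lam n t.+1 w = lam n t w - gamma *: (A (x n t w) - sample_mean ys n w))
  (beta0 : R) (hbeta0 : 0 < beta0)
  (tau : nat -> R) (htau1 : forall n, 1 < tau n)
  (htauinf : tau @ \oo --> +oo)
  (htausqrt : (fun n => tau n / Num.sqrt n%:R) @ \oo --> 0)
  (E : X -> R) (hEnn : forall z, dom Rf z -> 0 <= E z)
  (hEdag : E xdag = 0)
  (q : R) (hq : 0 < q <= 1) (M : R) (hM : 0 < M)
  (hvsc : forall z, dom Rf z ->
     E z <= fine (Rf z) - fine (Rf xdag) + M * `|A z - y| `^ q) :
  let tn (n : nat) (w : T) : nat :=
    first_index
      (fun t => `|A (x n t w) - sample_mean ys n w|
                  <= tau n * sample_sd ys n w / Num.sqrt n%:R)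
      (Num.truncn (beta0 * n%:R)) in
  let phi (n : nat) : R := sigma * tau n / (2 * Num.sqrt n%:R) in
  exists C : R, forall eps : R, 0 < eps ->
    \forall n \near \oo, exists2 B : set T, measurable B &
      B `<=` [set w | E (x n (tn n w) w) <= C * phi n `^ q] /\
      ((1 - eps)%:E <= P B)%E.
Proof.
move=> tn phi.
have [rE rge0] : (forall z, dom Rf z -> Rf z = (fine (Rf z))%:E) /\
    (forall z, 0 <= fine (Rf z)).
  split=> z; last exact: fine_ge0.
  by rewrite /dom /= => hz; rewrite fineK// ge0_fin_numE.
pose r z := fine (Rf z).
have hconv a b s : dom Rf a -> dom Rf b -> 0 <= s <= 1 ->
    dom Rf (s *: a + (1 - s) *: b) /\
    r (s *: a + (1 - s) *: b) + c0 * s * (1 - s) * `|a - b| ^+ 2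
      <= s * r a + (1 - s) * r b.
  move=> Da Db s01; have := hRconv _ _ _ Da Db s01.
  rewrite (rE _ Da) (rE _ Db) -!EFinM -EFinD => hle.
  have Dm : dom Rf (s *: a + (1 - s) *: b).
    rewrite /dom /=; move: hle; have := hRnn (s *: a + (1 - s) *: b).
    by case: (Rf _) => [u| |]// _; rewrite ltry.
  by split=> //; move: hle; rewrite (rE _ Dm) -EFinD lee_fin.
(* The step size restriction enters through this inequality alone. *)
have hAc u : gamma / 2 * `|A u| ^+ 2 <= c0 * `|u| ^+ 2.
  have h1 : `|A u| ^+ 2 <= (opnorm A * `|u|) ^+ 2.
    have hu := le_opnorm hA u.
    by rewrite ler_pXn2r ?nnegrE//; exact: le_trans hu.
  have := ler_wpM2l (ltW hgamma) h1.
  have := ler_wpM2r (sqr_ge0 `|u|) (ltW hgammaA).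
  lra.
(* Comparison with [xdag], where the functional is finite, forces a finite value at the
   minimizer. *)
have Dx n t w : dom Rf (x n t w).
  have := hx n t w xdag; rewrite (rE _ hxdagdom) -EFinB.
  have := hRnn (x n t w); rewrite /dom /=.
  by case: (Rf (x n t w)) => [u| |]// _; rewrite ltry.
have hxr n t w z : dom Rf z ->
    r (x n t w) - ip (lam n t w) (A (x n t w)) <= r z - ip (lam n t w) (A z).
  by move=> Dz; have := hx n t w z; rewrite (rE _ (Dx n t w)) (rE _ Dz) -!EFinB lee_fin.
have [K K0 hK] := discrepancy_principle_error hip hc0 hgamma hq hM
  (fun z _ => rge0 z) hconv hAc hxdagdom hxdagA hEnn hvsc.
have phi0 n : (0 < n)%N -> 0 < phi n.
  move=> n0; rewrite divr_gt0// ?mulr_gt0// ?sqrtr_gt0 ?ltr0n//.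
  exact: lt_trans (htau1 n).
have phiE n : phi n = sigma / 2 * (tau n / Num.sqrt n%:R).
  by rewrite /phi invfM; ring.
have phi_small e : 0 < e -> \forall n \near \oo, phi n <= e.
  move=> e0; near=> n.
  have : `|0 - tau n / Num.sqrt n%:R| < e / sigma.
    by near: n; apply: (cvgrPdist_lt _ _).1 htausqrt _ _; rewrite divr_gt0.
  rewrite sub0r normrN => /(le_lt_trans (ler_norm _)).
  rewrite ltr_pdivlMr// => h; rewrite phiE.
  have : 0 <= tau n / Num.sqrt n%:R.
    by rewrite divr_ge0 ?sqrtr_ge0// ltW// (lt_trans _ (htau1 n)).
  move=> h0; have := mulr_ge0 (ltW hsigma) h0; lra.
(* Here [n phi^2 = sigma^2 tau^2 / 4], and [tau > 1] gives [tau <= tau^2]. *)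
have nphi_large L : \forall n \near \oo, L <= n%:R * phi n ^+ 2.
  near=> n.
  have n0 : 0 < n%:R :> R by rewrite ltr0n; near: n; exact: nbhs_infty_gt.
  have -> : n%:R * phi n ^+ 2 = (sigma ^+ 2 / 4) * tau n ^+ 2.
    rewrite phiE !exprMn !exprVn sqr_sqrtr ?(ltW n0)//; field.
    by rewrite gt_eqF.
  have htL : 4 * L / sigma ^+ 2 <= tau n.
    by near: n; exact: (cvgryPge _).1 htauinf _.
  have s2 : 0 < sigma ^+ 2 by rewrite exprn_gt0.
  move: htL; rewrite ler_pdivrMr// => htL.
  have : tau n <= tau n ^+ 2.
    by rewrite expr2 ler_peMl ?(ltW (htau1 n))// ltW// (lt_trans _ (htau1 n)).
  move=> /(ler_wpM2r (ltW s2)); lra.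
exists K => eps eps0.
have hconc := sample_concentration hip hysrv hysind hysid hmean hvar
  phi eps hsigma eps0 phi0 phi_small nphi_large.
near=> n.
have n_gt0 : (0 < n)%N by near: n; exact: nbhs_infty_gt.
have phi1 : phi n <= 1 by near: n; exact: phi_small.
(* Multiplied by [beta0], this gives [beta0 n phi^2 >= K + beta0 > K], so the iteration budget
   suffices; the summand 1 makes the inequality strict. *)
have hlarge : K / beta0 + 1 <= n%:R * phi n ^+ 2 by near: n; exact: nphi_large.
have p0 := phi0 n n_gt0.
have [B mB [hB PB]] : exists2 B : set T, measurable B &
    (forall w, B w -> `|sample_mean ys n w - y| <= phi n / 4 /\
                      sigma / 2 <= sample_sd ys n w <= 2 * sigma) /\
    ((1 - eps)%:E <= P B)%E by near: n.
(* The event is defined by the sample mean and deviation, hence is measurable, although [E] and the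
   iterates are arbitrary functions. *)
exists B => //; split=> // w /hB[hmeanw /andP[sd_lo sd_hi]].
have tn0 : 0 <= tau n / Num.sqrt n%:R.
  by rewrite divr_ge0 ?sqrtr_ge0// ltW// (lt_trans _ (htau1 n)).
rewrite /= /tn; apply: (hK _ (fun t => x n t w) (fun t => lam n t w)) => //.
- by move=> t z; exact: hxr.
- by rewrite p0 phi1.
(* As [phi] is [sigma / 2] times [tau n / sqrt n], the bounds on the sample deviation place the
   threshold between [phi] and [4 phi]. *)
- have -> : tau n * sample_sd ys n w / Num.sqrt n%:R =
      sample_sd ys n w * (tau n / Num.sqrt n%:R) by ring.
  rewrite phiE ler_wpM2r//=.
  have := ler_wpM2r tn0 sd_hi; lra.
- have q0 : 0 <= q by rewrite ltW//; case/andP: hq.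
  have phiq : phi n `^ q <= 1.
    apply: (@le_trans _ _ (1 `^ q)); last by rewrite powR1.
    by rewrite ge0_ler_powR ?nnegrE ?(ltW p0).
  have Kphi : K * phi n `^ q <= K by rewrite ler_piMr// ltW.
  apply: le_lt_trans Kphi _.
  have hN : beta0 * n%:R <= (Num.truncn (beta0 * n%:R)).+1%:R.
    by rewrite ltW// truncnS_gt.
  apply: (@lt_le_trans _ _ (beta0 * n%:R * phi n ^+ 2)); last first.
    by rewrite ler_wpM2r ?sqr_ge0.
  have := ler_wpM2l (ltW hbeta0) hlarge.
  by rewrite mulrDr mulrCA divff ?gt_eqF// !mulr1; lra.
Unshelve. all: by end_near.
Qed.
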